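(* Let $\mu,\nu\in\mathcal{P}(\mathcal{X})$, $\varepsilon>0$, $c:\mathcal{X}\times\mathcal{X}\to\mathbb{R}_+$ measurable with $\int c\,d\mu\otimes\nu<\infty$, and $K(x,y)=\exp(-c(x,y)/\varepsilon)$. Assume there exist $p>0$ and $\delta>0$ with \[ \lim_{r\to\infty}\frac{\sup_{x,y\in B_r}c(x,y)}{r^p}=0\quad\text{and}\quad\lim_{r\to\infty}\frac{\max\{\mu(B_r^{\mathsf c}),\nu(B_r^{\mathsf c})\}}{\exp(-r^{p+\delta})}=0 . \] Let $\alpha(r)=\exp(-r^{p+\delta/2})$. Then there exists $\underline m>0$ such that for all $m_1=m_2\ge\underline m$, each step of Sinkhorn's algorithm, i.e., the map $\Phi:=S\circ L_{K,\nu}\circ S\circ L_{K^\top,\mu}$, initialized with $g^{(0)}\in\mathcal{G}^{\mu}_{\alpha,\alpha}\setminus\{0\}$, $g^{(0)}\ge0$, is a strict contraction with respect to Hilbert's metric $d_{\mathcal{G}^{\mu}_{\alpha,\alpha}}$ corresponding to $\mathcal{G}^{\mu}_{\alpha,\alpha}$ (that is, there is $\kappa\in(0,1)$ with $d_{\mathcal{G}^{\mu}_{\alpha,\alpha}}(\Phi g,\Phi\tilde g)\le\kappa\, d_{\mathcal{G}^{\mu}_{\alpha,\alpha}}(g,\tilde g)$ for the functions $g,\tilde g$ arising in this way).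
   Context: $\mathcal{X}$ is a Polish space with metric $d_{\mathcal{X}}$, $x_0$ fixed, $B_r=\{x:d_{\mathcal{X}}(x_0,x)\le r\}$, $B_r^{\mathsf c}=\mathcal{X}\setminus B_r$. $L_{K,\nu}f(x)=\int K(x,y)f(y)\,\nu(dy)$, $L_{K^\top,\mu}g(y)=\int K(x,y)g(x)\,\mu(dx)$, and $S(g)=1/g$. Sinkhorn's algorithm (for the entropic optimal transport problem $\inf_{\pi\in\Pi(\mu,\nu)}\int c\,d\pi+\varepsilon H(\pi,\mu\otimes\nu)$, written in terms of the multiplicative dual potential for $\mu$) iterates $g^{(n+1)}=\Phi(g^{(n)})$. For $\rho\in\mathcal{P}(\mathcal{X})$, $0<m_1\le m_2$ and tail functions $\alpha,\tilde\alpha$ (non-increasing, $(0,\infty)\to[0,\infty)$, tending to $0$): $\mathcal{F}^{\rho}_{\alpha,\tilde\alpha}$ is the set of $f\in L^2(\rho)$ with $f\mathbf 1_{B_{m_2}}\ge0$ $\rho$-a.s., $\int_{B_r^{\mathsf c}}f_+\,d\rho\le\alpha(r)\int f\,d\rho$ for all $r\ge m_1$, $\int_{B_r^{\mathsf c}}f_-\,d\rho\le\tilde\alpha(r)\int f\,d\rho$ for all $r\ge m_2$; $\mathcal{G}^{\rho}_{\alpha,\tilde\alpha}=\{g\in L^2(\rho):\int fg\,d\rho\ge0\ \forall f\in\mathcal{F}^{\rho}_{\alpha,\tilde\alpha}\}$. Hilbert's metric for a cone $C$: $f\le_C g$ iff $g-f\in C$; $f\sim_C g$ iff $f\le_C bg$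 and $g\le_C b'f$ for some $b,b'>0$; $M(f,g)=\inf\{b>0:bg-f\in C\}$, $m(f,g)=\sup\{a>0:f-ag\in C\}$; $d_C(f,g)=\log(M/m)$ if $f\sim_C g$, $g\ne0$, and $\infty$ otherwise. *)

(* Defs.v *)
From HB Require Import structures.
From mathcomp Require Import all_boot all_order all_algebra.
From mathcomp Require Import all_classical all_reals all_analysis.
Set Implicit Arguments. Unset Strict Implicit. Unset Printing Implicit Defensive.
Import Order.TTheory GRing.Theory Num.Theory.
Import numFieldNormedType.Exports.
Local Open Scope classical_set_scope.
Local Open Scope ring_scope.

Section Defs.
Context {d : measure_display} {X : measurableType d} {R : realType}.

Definition dball (dX : X -> X -> R) (x : X) (e : R) := [set y | dX x y < e].
Definition dopen (dX : X -> X -> R) (A : set X) :=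
  forall x, A x -> exists2 e : R, 0 < e & dball dX x e `<=` A.
Definition is_metric (dX : X -> X -> R) :=
  [/\ forall x y, 0 <= dX x y, forall x y, dX x y = 0 <-> x = y,
      forall x y, dX x y = dX y x &
      forall x y z, dX x z <= dX x y + dX y z].
Definition dcauchy (dX : X -> X -> R) (u : nat -> X) :=
  forall e : R, 0 < e -> exists N, forall n m, (N <= n)%N -> (N <= m)%N ->
    dX (u n) (u m) < e.
Definition dconverges (dX : X -> X -> R) (u : nat -> X) (x : X) :=
  (fun n => dX (u n) x) @ \oo --> (0 : R).
Definition polish_borel (dX : X -> X -> R) :=
  [/\ is_metric dX,
      forall u, dcauchy dX u -> exists x, dconverges dX u x,
      exists D : set X, countable D /\
        forall x (e : R), 0 < e -> exists2 y, D y & dX x y < e &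
      (@measurable d X) = <<s dopen dX >>].

Definition Bclosed (dX : X -> X -> R) (x0 : X) (r : R) := [set x | dX x0 x <= r].

Definition L2 (rho : {measure set X -> \bar R}) (f : X -> R) :=
  measurable_fun setT f /\ (\int[rho]_x ((f x) ^+ 2)%:E < +oo)%E.

Definition pos_part (f : X -> R) := fun x => Num.max (f x) 0.
Definition neg_part (f : X -> R) := fun x => Num.max (- f x) 0.

Definition coneF (dX : X -> X -> R) (x0 : X) (m1 m2 : R)
    (alpha alpha' : R -> R) (rho : {measure set X -> \bar R}) : set (X -> R) :=
  [set f | [/\ L2 rho f,
     {ae rho, forall x, Bclosed dX x0 m2 x -> 0 <= f x},
     forall r, m1 <= r ->
       Rintegral rho (~` Bclosed dX x0 r) (pos_part f)
         <= alpha r * Rintegral rho setT f &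
     forall r, m2 <= r ->
       Rintegral rho (~` Bclosed dX x0 r) (neg_part f)
         <= alpha' r * Rintegral rho setT f]].

Definition coneG (dX : X -> X -> R) (x0 : X) (m1 m2 : R)
    (alpha alpha' : R -> R) (rho : {measure set X -> \bar R}) : set (X -> R) :=
  [set g | L2 rho g /\
     forall f, coneF dX x0 m1 m2 alpha alpha' rho f ->
       0 <= Rintegral rho setT (fun x => f x * g x)].

(** Hilbert's projective metric for a cone C of functions in L^2(rho);
    "g <> 0" means g is not the zero element of L^2(rho). *)
Definition cone_le (C : set (X -> R)) (f g : X -> R) := C (g \- f).
Definition cone_equiv (C : set (X -> R)) (f g : X -> R) :=
  (exists2 b : R, 0 < b & cone_le C f (b \*o g)) /\
  (exists2 b' : R, 0 < b' & cone_le C g (b' \*o f)).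
Definition hilbM (C : set (X -> R)) (f g : X -> R) : R :=
  inf [set b : R | 0 < b /\ C (b \*o g \- f)].
Definition hilbm (C : set (X -> R)) (f g : X -> R) : R :=
  sup [set a : R | 0 < a /\ C (f \- a \*o g)].
Definition ae_zero (rho : {measure set X -> \bar R}) (g : X -> R) :=
  {ae rho, forall x, g x = 0}.
Definition hilbert_metric (rho : {measure set X -> \bar R})
    (C : set (X -> R)) (f g : X -> R) : \bar R :=
  if `[< cone_equiv C f g /\ ~ ae_zero rho g >]
  then (ln (hilbM C f g / hilbm C f g))%:E else +oo%E.

Definition LK (K : X -> X -> R) (nu : {measure set X -> \bar R}) (f : X -> R) :=
  fun x => Rintegral nu setT (fun y => K x y * f y).
Definition LKT (K : X -> X -> R) (mu : {measure set X -> \bar R}) (g : X -> R) :=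
  fun y => Rintegral mu setT (fun x => K x y * g x).
(** S(g) = 1/g  (with the MathComp convention 0^-1 = 0) *)
Definition Sinv (g : X -> R) := fun x => (g x)^-1.
Definition sinkhorn_map (K : X -> X -> R) (mu nu : {measure set X -> \bar R})
  (g : X -> R) := Sinv (LK K nu (Sinv (LKT K mu g))).

End Defs.

(* Main.v *)
(** The Sinkhorn map is nonlinear, but for a given pair g, g' there is a linear
    operator T (depending on the pair) with int k (Phi g) = int (T k) g and
    int k (Phi g') = int (T k) g' for all test functions k. Hence Phi contracts
    the Hilbert metric of the dual cone G as soon as T maps the cone F of test
    functions into itself with a finite diameter that does not depend on g, g',
    by Birkhoff's argument.

    Put q x = exp (max (d(x0, x), m)^p) and Q = exp (m^p). For m large,
    K x y >= 1 / (q x q y), and all tails beyond radius m, even weighted with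
    q^2, are smaller than any fixed power of 1/Q. If k in F has integral 1, this
    yields |T k| <= 128 Q^8 everywhere and T k >= Q^-8 / 256 on the ball of
    radius m. As mu (B_r^c) is much smaller than alpha r for r >= m, such
    functions lie between two multiples of the constant 1 in the order of F. *)

Require Import Defs.
From HB Require Import structures.
From mathcomp Require Import all_boot all_order all_algebra.
From mathcomp Require Import all_classical all_reals all_analysis.
From mathcomp Require Import measurable_realfun.
From mathcomp Require Import ring lra.
Import Order.TTheory GRing.Theory Num.Theory.
Set Implicit Arguments. Unset Strict Implicit. Unset Printing Implicit Defensive.
Import numFieldNormedType.Exports.
Local Open Scope classical_set_scope.
Local Open Scope ring_scope.

(** Origin of T: put u = LKT g, v = 1/u, w = LK v, s = 1/w, and u', v', w', s' for g'. As v v' u =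
    v' and s s' w' = s, the linear map f |-> s s' LK (v v' LKT f) sends g to s and, by symmetry, g'
    to s': the first reciprocal exchanges the roles of the pair, the second restores them. T is its
    adjoint with respect to mu. The obstacle is that a test function k may be negative off the ball,
    where the bounds on v and s grow like q. So the mass of k in the ball, multiplied by fixed
    powers of 1/Q, has to win against the tail of k weighted by q^2, one factor q for each member of
    the pair. This is why the exponent of alpha lies halfway between p and p + delta. The half above
    p makes alpha r beat weights like exp (2 (2 r)^p), so that the tail of k stays negligible. The
    half below p + delta makes mu (B_r^c) beat alpha r with a large constant to spare, so that
    bounded functions which are not too small on the ball meet the tail conditions of F. *)

Section Integration.
Context {R : realType} {d : measure_display} {X : measurableType d}.
Variable rho : probability X R.
Implicit Types (f g : X -> R) (D : set X).

Lemma integrable_le_norm D f g : measurable D -> measurable_fun D f ->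
  (forall x, D x -> `|f x| <= g x) ->
  rho.-integrable D (EFin \o g) -> rho.-integrable D (EFin \o f).
Proof.
move=> mD mf fg; apply: le_integrable => //; first exact/measurable_EFinP.
by move=> x Dx /=; rewrite lee_fin (le_trans (fg x Dx))// ler_norm.
Qed.

Lemma integrable_cstP D (r : R) : measurable D ->
  rho.-integrable D (EFin \o cst r).
Proof. by move=> mD; exact: finite_measure_integrable_cst. Qed.

Lemma integrable_addr D f g : measurable D ->
  rho.-integrable D (EFin \o f) -> rho.-integrable D (EFin \o g) ->
  rho.-integrable D (EFin \o (fun x => f x + g x)).
Proof.
by move=> mD If Ig; have := integrableD mD If Ig; exact: eq_integrable.
Qed.

Lemma integrable_scaler D (a : R) f : measurable D ->
  rho.-integrable D (EFin \o f) ->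
  rho.-integrable D (EFin \o (fun x => a * f x)).
Proof.
by move=> mD If; have := integrableZl mD a If; exact: eq_integrable.
Qed.

Lemma integrable_measurable D f :
  rho.-integrable D (EFin \o f) -> measurable_fun D f.
Proof. by move=> /measurable_int/measurable_EFinP. Qed.

(** Replacing [g] by the maximum of [f] and [g], which equals it almost everywhere on [D], reduces
    the claim to a pointwise inequality. *)
Lemma ae_le_Rintegral D f g : measurable D ->
  rho.-integrable D (EFin \o f) -> rho.-integrable D (EFin \o g) ->
  {ae rho, forall x, D x -> f x <= g x} ->
  \int[rho]_(x in D) f x <= \int[rho]_(x in D) g x.
Proof.
move=> mD If Ig fg.
have mf := integrable_measurable If; have mg := integrable_measurable Ig.
have Imax : rho.-integrable D (EFin \o (fun x => Num.max (f x) (g x))).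
  apply: (integrable_le_norm (g := fun x => `|f x| + `|g x|)) => //.
  - exact: measurable_maxr.
  - move=> x _; rewrite /Num.max; case: ifP => _.
      by rewrite lerDr.
    by rewrite lerDl.
  - by apply: integrable_addr => //; exact: integrable_norm.
suff -> : \int[rho]_(x in D) g x = \int[rho]_(x in D) Num.max (f x) (g x).
  apply: le_Rintegral => // x _; by rewrite le_max lexx.
congr fine; apply: ae_eq_integral => //.
- exact: measurable_int Ig.
- exact: measurable_int Imax.
apply: filterS fg => x h Dx /=; congr EFin.
by rewrite max_r // h.
Qed.

Lemma Rintegral_split D f : measurable D ->
  rho.-integrable setT (EFin \o f) ->
  \int[rho]_x f x = \int[rho]_(x in D) f x + \int[rho]_(x in ~` D) f x.
Proof.
move=> mD If; rewrite -Rintegral_setU//.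
- by rewrite setUv.
- exact: measurableC.
- by rewrite setUv.
- by apply/disj_setPS => x [].
Qed.

Lemma integrable_restr D f : measurable D ->
  rho.-integrable setT (EFin \o f) -> rho.-integrable D (EFin \o f).
Proof. by move=> mD; apply: integrableS. Qed.

Lemma L2P f : L2 rho f <->
  measurable_fun setT f /\ rho.-integrable setT (EFin \o (fun x => f x ^+ 2)).
Proof.
split=> -[mf If]; split => //.
  apply/integrableP; split; first exact/measurable_EFinP/measurable_funX.
  under eq_integral do rewrite gee0_abs ?lee_fin ?sqr_ge0//.
  exact: If.
exact: integrable_lty If.
Qed.

Lemma L2_mul_integrable f g : L2 rho f -> L2 rho g ->
  rho.-integrable setT (EFin \o (fun x => f x * g x)).
Proof.
move=> /L2P[mf If] /L2P[mg Ig].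
apply: (integrable_le_norm (g := fun x => f x ^+ 2 + g x ^+ 2)) => //.
- exact: measurable_funM.
- move=> x _; rewrite ler_norml; apply/andP; split; nra.
- exact: integrable_addr.
Qed.

Lemma L2_cst (r : R) : L2 rho (cst r).
Proof.
by apply/L2P; split => //; exact: (integrable_cstP (r ^+ 2)).
Qed.

Lemma L2_integrable f : L2 rho f -> rho.-integrable setT (EFin \o f).
Proof.
move=> f2; have := L2_mul_integrable f2 (L2_cst 1).
by apply: eq_integrable => // x _ /=; rewrite mulr1.
Qed.

Lemma L2_comb (a b : R) f g : L2 rho f -> L2 rho g ->
  L2 rho (fun x => a * f x + b * g x).
Proof.
move=> f2 g2; have fg := L2_mul_integrable f2 g2.
move: f2 g2 => /L2P[mf If] /L2P[mg Ig]; apply/L2P; split.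
  by apply: measurable_funD; apply: measurable_funM.
have := integrable_addr measurableT
  (integrable_scaler (a ^+ 2) measurableT If)
  (integrable_addr measurableT
  (integrable_scaler (2 * a * b) measurableT fg)
  (integrable_scaler (b ^+ 2) measurableT Ig)).
apply: eq_integrable => // x _ /=; congr EFin; ring.
Qed.

Lemma L2_le_norm f g : measurable_fun setT f -> (forall x, `|f x| <= g x) ->
  L2 rho g -> L2 rho f.
Proof.
move=> mf fg /L2P[mg Ig]; apply/L2P; split => //.
apply: (integrable_le_norm (g := fun x => g x ^+ 2)) => //.
  exact: measurable_funX.
move=> x _; rewrite normrX; apply: lerXn2r => //; rewrite nnegrE//.
exact: le_trans (fg x).
Qed.

End Integration.

(** * Kernel operators *)

Section Kernel.
Context {R : realType} {d : measure_display} {X : measurableType d}.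
Variable K : X -> X -> R.
Hypothesis mK : measurable_fun [set: X * X] (fun z : X * X => K z.1 z.2).
Hypothesis K0 : forall x y, 0 <= K x y.
Hypothesis K1 : forall x y, K x y <= 1.

Lemma kernel_sectionl x : measurable_fun setT (K x).
Proof. exact: (measurableT_comp mK (pair1_measurable x)). Qed.

Variable rho : probability X R.
Implicit Types f g : X -> R.

Lemma kernel_integrable f x : rho.-integrable setT (EFin \o f) ->
  rho.-integrable setT (EFin \o (fun y => K x y * f y)).
Proof.
move=> If; apply: (integrable_le_norm (g := Num.norm \o f)) => //.
- by apply: measurable_funM (integrable_measurable If); exact: kernel_sectionl.
- by move=> y _; rewrite normrM ger0_norm// ler_piMl.
- exact: integrable_norm.
Qed.

Lemma LK_le_norm f x : rho.-integrable setT (EFin \o f) ->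
  `|LK K rho f x| <= \int[rho]_y `|f y|.
Proof.
move=> If; apply: le_trans (le_normr_Rintegral measurableT (kernel_integrable x If)) _.
apply: le_Rintegral => //.
- exact: integrable_norm (kernel_integrable x If).
- exact: integrable_norm.
- by move=> y _; rewrite normrM ger0_norm// ler_piMl.
Qed.

Lemma kernel_prod_integrable (rho' : probability X R) f g :
  rho.-integrable setT (EFin \o f) -> rho'.-integrable setT (EFin \o g) ->
  (rho \x rho')%E.-integrable [set: X * X]
    (EFin \o (fun z : X * X => K z.1 z.2 * (f z.1 * g z.2))).
Proof.
move=> If Ig.
have mf := integrable_measurable If; have mg := integrable_measurable Ig.
have mF : measurable_fun [set: X * X] (fun z : X * X => f z.1 * g z.2).
  by apply: measurable_funM; exact: measurableT_comp.
have mH : measurable_fun [set: X * X]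
    (EFin \o (fun z : X * X => K z.1 z.2 * (f z.1 * g z.2))).
  by apply/measurable_EFinP; exact: measurable_funM.
apply: (integrable12ltyP rho rho' mH).2.
have Ig' : (\int[rho']_y `|(g y)%:E|)%E \is a fin_num.
  exact: integrable_fin_num (integrable_abse Ig).
apply: (@le_lt_trans _ _ (\int[rho]_x (`|(f x)%:E| * \int[rho']_y `|(g y)%:E|)))%E.
  apply: ge0_le_integral => //.
  - by move=> x _; exact: integral_ge0.
  - apply: (@measurable_fun_fubini_tonelli_F _ _ _ _ _ rho' (abse \o
      (EFin \o (fun z : X * X => K z.1 z.2 * (f z.1 * g z.2))))) => //=.
    exact: measurableT_comp.
  - apply: emeasurable_funM => //; apply: measurableT_comp => //.
    exact/measurable_EFinP.
  - move=> x _; rewrite -ge0_integralZl//; last first.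
      by apply: measurableT_comp => //; exact/measurable_EFinP.
    apply: ge0_le_integral => //.
    + apply: measurableT_comp => //; apply: measurableT_comp mH _.
      exact: pair1_measurable.
    + apply: emeasurable_funM => //; apply: measurableT_comp => //.
      exact/measurable_EFinP.
    + move=> y _ /=; rewrite lee_fin !normrM.
      by rewrite (ger0_norm (K0 _ _)) ler_piMl// mulr_ge0.
rewrite -(fineK Ig') ge0_integralZr//.
- apply: lte_mul_pinfty => //.
  + exact: integral_ge0.
  + exact: integrable_fin_num (integrable_abse If).
  + by rewrite ltry.
- by apply: measurableT_comp => //; exact/measurable_EFinP.
- by rewrite lee_fin fine_ge0// integral_ge0.
Qed.

(** Links the extended-real inner integrals of Fubini's theorem to the real-valued [LK]; [a] stands
    for the factor that depends on the outer variable. *)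
Lemma LK_scale_EFin f x (a : R) : rho.-integrable setT (EFin \o f) ->
  (\int[rho]_y (K x y * (a * f y))%:E)%E = (a * LK K rho f x)%:E.
Proof.
move=> If; have IKf := kernel_integrable x If.
rewrite /LK -RintegralZl// /Rintegral fineK.
  by apply: eq_integral => y _; rewrite mulrCA.
by apply: integrable_fin_num => //; exact: integrable_scaler.
Qed.

End Kernel.

Section KernelDuality.
Context {R : realType} {d : measure_display} {X : measurableType d}.
Variables (K : X -> X -> R) (mu nu : probability X R).
Hypothesis mK : measurable_fun [set: X * X] (fun z : X * X => K z.1 z.2).
Hypothesis K0 : forall x y, 0 <= K x y.
Hypothesis K1 : forall x y, K x y <= 1.
Implicit Types f g : X -> R.

Lemma measurable_kernel_flip :
  measurable_fun [set: X * X] (fun z : X * X => K z.2 z.1).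
Proof. exact: (measurableT_comp mK (@measurable_swap _ _ X X)). Qed.

Lemma LKT_flip f : LKT K mu f = LK (fun y x => K x y) mu f.
Proof. by []. Qed.

Lemma measurable_LK f : nu.-integrable setT (EFin \o f) ->
  measurable_fun setT (LK K nu f).
Proof.
move=> If; apply/measurable_EFinP.
(* [LK K nu f] is the inner integral of the kernel times the product of the constant 1 and [f], so
   its measurability is part of Fubini's theorem. *)
have I1 : nu.-integrable setT (EFin \o cst (1 : R)) by exact: integrable_cstP.
have := measurable_fubini_F (kernel_prod_integrable mK K0 K1 I1 If).
apply: eq_measurable_fun => x _ /=.
by rewrite /fubini_F LK_scale_EFin// mul1r.
Qed.

Lemma LK_duality f g :
  mu.-integrable setT (EFin \o f) -> nu.-integrable setT (EFin \o g) ->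
  \int[mu]_x (f x * LK K nu g x) = \int[nu]_y (LKT K mu f y * g y).
Proof.
move=> If Ig; congr fine.
have IF := kernel_prod_integrable mK K0 K1 If Ig.
transitivity (\int[mu]_x \int[nu]_y (K x y * (f x * g y))%:E)%E.
  by apply: eq_integral => x _; rewrite LK_scale_EFin.
rewrite (Fubini IF)/=; apply: eq_integral => y _.
under eq_integral do rewrite (mulrC (f _)).
rewrite LKT_flip mulrC; apply: (LK_scale_EFin measurable_kernel_flip) => //.
Qed.

End KernelDuality.

(** * Pointwise bounds for the kernel operators *)

Section KernelBounds.
Context {R : realType} {d : measure_display} {X : measurableType d}.
Variables (K : X -> X -> R) (rho : probability X R) (B : set X) (q : X -> R) (Q : R).
Hypothesis mK : measurable_fun [set: X * X] (fun z : X * X => K z.1 z.2).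
Hypothesis K0 : forall x y, 0 <= K x y.
Hypothesis K1 : forall x y, K x y <= 1.
Hypothesis Kq : forall x y, (q x * q y)^-1 <= K x y.
Hypothesis mB : measurable B.
Hypothesis Q1 : 1 <= Q.
Hypothesis qB : forall x, B x -> q x = Q.
Hypothesis qQ : forall x, Q <= q x.
Implicit Types f g : X -> R.

(** On [B] the kernel is at least [(Q * q x)^-1] and [f] is nonnegative; off [B] the kernel is at
    most 1, so [f] can take away no more than its negative mass there. *)
Lemma LK_ge f (A t : R) x : rho.-integrable setT (EFin \o f) ->
  {ae rho, forall y, B y -> 0 <= f y} ->
  A <= \int[rho]_(y in B) f y ->
  \int[rho]_(y in ~` B) neg_part f y <= t ->
  (Q * q x)^-1 * A - t <= LK K rho f x.
Proof.
move=> If f0 Af ft; have IKf := kernel_integrable mK K0 K1 x If.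
have mCB : measurable (~` B) by exact: measurableC.
have q0 y : 0 < q y by rewrite (lt_le_trans _ (qQ y))// (lt_le_trans ltr01).
have Q0 : 0 < Q by rewrite (lt_le_trans ltr01).
rewrite /LK (Rintegral_split mB IKf) lerD//.
  apply: (@le_trans _ _ (\int[rho]_(y in B) ((Q * q x)^-1 * f y))).
    rewrite RintegralZl//; last exact: integrable_restr If.
    by rewrite ler_pM2l// invr_gt0 mulr_gt0.
  apply: ae_le_Rintegral => //.
  - by apply: integrable_scaler => //; exact: integrable_restr If.
  - exact: integrable_restr IKf.
  - apply: filterS f0 => y fy By; apply: ler_wpM2r; first exact: fy.
    by rewrite -(qB By) mulrC.
have Ineg : rho.-integrable (~` B) (EFin \o neg_part f).
  apply: (integrable_le_norm (g := Num.norm \o f)) => //.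
  - apply: measurable_maxr => //; apply: measurableT_comp => //.
    exact: (integrable_measurable (integrable_restr mCB If)).
  - move=> y _; rewrite /neg_part /Num.max; case: ifP => _ /=.
      by rewrite normr0.
    by rewrite normrN.
  - by apply: integrable_restr mCB _; exact: integrable_norm.
rewrite lerNl; apply: le_trans ft.
rewrite -[leLHS]mulN1r -RintegralZl//; last exact: integrable_restr IKf.
apply: le_Rintegral => //.
  by apply: integrable_scaler => //; exact: integrable_restr IKf.
move=> y _; rewrite /neg_part mulN1r -mulrN le_max.
have [fy|fy] := leP 0 (f y).
  by apply/orP; right; rewrite mulr_ge0_le0// oppr_le0.
by apply/orP; left; rewrite ler_piMl// oppr_ge0 ltW.
Qed.

Lemma LK_potential_bounds g : rho.-integrable setT (EFin \o g) ->
  {ae rho, forall x, 0 <= g x} ->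
  \int[rho]_x g x <= 2 * \int[rho]_(x in B) g x ->
  forall x, (2 * Q * q x)^-1 * \int[rho]_y g y <= LK K rho g x <= \int[rho]_y g y.
Proof.
move=> Ig g0 gB x; apply/andP; split; last first.
  apply: ae_le_Rintegral => //; first exact: kernel_integrable.
  by apply: filterS g0 => y gy _; rewrite ler_piMl.
have -> : (2 * Q * q x)^-1 * \int[rho]_y g y =
    (Q * q x)^-1 * (2^-1 * \int[rho]_y g y) - 0.
  by rewrite -(mulrA 2) invfM subr0; ring.
apply: LK_ge => //.
- by apply: filterS g0 => y gy _.
- by rewrite ler_pdivrMl.
- have -> : \int[rho]_(y in ~` B) neg_part g y = \int[rho]_(y in ~` B) (cst 0 y).
    congr fine; apply: ae_eq_integral => //.
    + exact: measurableC.
    + apply/measurable_EFinP/measurable_maxr => //; apply: measurableT_comp => //.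
      apply: (integrable_measurable (integrable_restr _ Ig)).
      exact: measurableC.
    + by apply/measurable_EFinP; exact: measurable_cst.
    + apply: filterS g0 => y gy _ /=; congr EFin.
      by rewrite /neg_part max_r// oppr_le0.
  by rewrite Rintegral_cst ?mul0r//; exact: measurableC.
Qed.

End KernelBounds.

(** * Bounds for one Sinkhorn step *)

Lemma measurable_fun_pos_inv (R : realType) (d : measure_display)
    (X : measurableType d) (f : X -> R) :
  (forall x, 0 < f x) -> measurable_fun setT f ->
  measurable_fun setT (fun x => (f x)^-1).
Proof.
move=> f0 mf; apply: (eq_measurable_fun (fun x => f x `^ (-1))) => [x _|].
  by rewrite powR_inv1// ltW.
exact: (measurableT_comp (measurable_powR _) mf).
Qed.

Section SinkhornBounds.
Context {R : realType} {d : measure_display} {X : measurableType d}.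
Variables (K : X -> X -> R) (mu nu : probability X R).
Variables (B : set X) (q : X -> R) (Q tau : R).
Hypothesis mK : measurable_fun [set: X * X] (fun z : X * X => K z.1 z.2).
Hypothesis K0 : forall x y, 0 <= K x y.
Hypothesis K1 : forall x y, K x y <= 1.
Hypothesis Kq : forall x y, (q x * q y)^-1 <= K x y.
Hypothesis mB : measurable B.
Hypothesis Q1 : 1 <= Q.
Hypothesis qB : forall x, B x -> q x = Q.
Hypothesis qQ : forall x, Q <= q x.
Hypothesis mq : measurable_fun setT q.
(** The exponents come from the last lower bound, [sinkhorn_op_ge]: its main term is P^8 / 128 and
    its loss is 64 Q^6 tau. With 14 = 6 + 8 and 2^14 = 64 * 256 the loss is exactly half of the main
    term. *)
Hypothesis tauE : tau = Q^-1 ^+ 14 / 2 ^+ 14.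
Hypothesis muq : mu.-integrable setT (EFin \o (fun x => q x ^+ 2)).
Hypothesis nuq : nu.-integrable setT (EFin \o (fun x => q x ^+ 2)).
Hypothesis nutau : \int[nu]_(x in ~` B) (q x ^+ 2) <= tau.
Implicit Types f g k : X -> R.

Let mCB : measurable (~` B). Proof. exact: measurableC. Qed.

Let Q0 : 0 < Q. Proof. exact: lt_le_trans ltr01 Q1. Qed.

Let q1 x : 1 <= q x. Proof. exact: le_trans Q1 (qQ x). Qed.

Let q0 x : 0 < q x. Proof. exact: lt_le_trans ltr01 (q1 x). Qed.

Let q_le_sqr x : q x <= q x ^+ 2.
Proof. by rewrite expr2 ler_peMl// ltW. Qed.

Let P := Q^-1.

Let P0 : 0 < P. Proof. by rewrite invr_gt0. Qed.

Let P1 : P <= 1. Proof. by rewrite invf_le1. Qed.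

Let QP : Q * P = 1. Proof. by rewrite divff// gt_eqF. Qed.

Let tau0 : 0 <= tau.
Proof. by rewrite tauE divr_ge0// ltW// exprn_gt0. Qed.

Let tau_half : tau <= 2^-1.
Proof.
have : P ^+ 14 <= 1 by rewrite exprn_ile1// ltW.
rewrite tauE -/P; lra.
Qed.

Let Q2tau : Q ^+ 2 * tau <= P ^+ 6 / 2 ^+ 14.
Proof.
have -> : Q ^+ 2 * tau = (Q * P) ^+ 2 * (P ^+ 6 * P ^+ 6) / 2 ^+ 14.
  by rewrite tauE -/P; field.
rewrite QP expr1n mul1r ler_pM2r ?invr_gt0 ?exprn_gt0//.
by rewrite ler_piMr ?exprn_ile1 ?exprn_ge0 // ltW.
Qed.

Let Q6tau : Q ^+ 6 * tau = P ^+ 8 / 2 ^+ 14.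
Proof.
have -> : Q ^+ 6 * tau = (Q * P) ^+ 6 * P ^+ 8 / 2 ^+ 14.
  by rewrite tauE -/P; field.
by rewrite QP expr1n mul1r.
Qed.

Let nuB : 2^-1 <= \int[nu]_(x in B) 1.
Proof.
have I1 : nu.-integrable setT (EFin \o cst (1 : R)) by exact: integrable_cstP.
have E1 : \int[nu]_x (cst 1 x : R) = 1.
  rewrite (Rintegral_cst nu measurableT 1) mul1r.
  exact: (congr1 fine (probability_setT nu)).
have := Rintegral_split mB I1; rewrite E1.
suff : \int[nu]_(x in ~` B) (cst 1 x : R) <= tau by move: tau_half => /=; lra.
apply: le_trans nutau; apply: le_Rintegral => //.
- exact: integrable_restr I1.
- exact: integrable_restr nuq.
- by move=> x _; rewrite exprn_ege1.
Qed.

Let nuq1 : nu.-integrable setT (EFin \o q).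
Proof.
apply: (integrable_le_norm (g := fun x => q x ^+ 2)) => // x _.
by rewrite ger0_norm// ltW.
Qed.

Let nuqQ : \int[nu]_x q x <= 2 * Q.
Proof.
rewrite (Rintegral_split mB nuq1).
have : \int[nu]_(x in B) q x <= Q.
  rewrite (_ : \int[nu]_(x in B) q x = \int[nu]_(x in B) Q); last first.
    by apply: eq_Rintegral => x /set_mem /qB.
  rewrite Rintegral_cst// ler_piMr ?(ltW Q0)// -lee_fin fineK ?probability_le1//.
  exact: fin_num_measure.
have : \int[nu]_(x in ~` B) q x <= tau.
  apply: le_trans nutau; apply: le_Rintegral => //.
  - exact: integrable_restr nuq1.
  - exact: integrable_restr nuq.
move: tau_half Q1; lra.
Qed.

Let nuq2 : \int[nu]_x (q x ^+ 2) <= 2 * Q ^+ 2.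
Proof.
rewrite (Rintegral_split mB nuq).
have : \int[nu]_(x in B) (q x ^+ 2) <= Q ^+ 2.
  rewrite (_ : \int[nu]_(x in B) _ = \int[nu]_(x in B) (Q ^+ 2)); last first.
    by apply: eq_Rintegral => x /set_mem /qB ->.
  rewrite Rintegral_cst// ler_piMr ?exprn_ge0 ?(ltW Q0)//.
  rewrite -lee_fin fineK ?probability_le1//.
  exact: fin_num_measure.
have : 1 <= Q ^+ 2 by rewrite exprn_ege1.
move: tau_half nutau; lra.
Qed.

Section OnePotential.
Variable g : X -> R.
Hypothesis Ig : mu.-integrable setT (EFin \o g).
Hypothesis g0 : {ae mu, forall x, 0 <= g x}.
Hypothesis gI : 0 < \int[mu]_x g x.
Hypothesis gB : \int[mu]_x g x <= 2 * \int[mu]_(x in B) g x.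

Let I := \int[mu]_x g x.

Lemma LKT_bounds y : (2 * Q * q y)^-1 * I <= LKT K mu g y <= I.
Proof.
rewrite LKT_flip; apply: (@LK_potential_bounds _ _ _ _ mu B q Q) => //.
- exact: measurable_kernel_flip.
- by move=> x z; rewrite mulrC.
Qed.

Lemma LKT_gt0 y : 0 < LKT K mu g y.
Proof.
have /andP[+ _] := LKT_bounds y; apply: lt_le_trans.
by rewrite mulr_gt0 ?invr_gt0 ?mulr_gt0.
Qed.

Lemma measurable_LKT f : mu.-integrable setT (EFin \o f) ->
  measurable_fun setT (LKT K mu f).
Proof.
move=> If; rewrite LKT_flip; apply: measurable_LK => //.
exact: measurable_kernel_flip.
Qed.

Lemma measurable_Sinv_LKT : measurable_fun setT (Sinv (LKT K mu g)).
Proof.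
by apply: measurable_fun_pos_inv; [exact: LKT_gt0|exact: measurable_LKT].
Qed.

Lemma Sinv_LKT_bounds y : I^-1 <= Sinv (LKT K mu g) y <= 2 * Q * I^-1 * q y.
Proof.
have /andP[lo hi] := LKT_bounds y; have u0 := LKT_gt0 y.
rewrite /Sinv lef_pV2 ?posrE// hi/=.
have -> : 2 * Q * I^-1 * q y = ((2 * Q * q y)^-1 * I)^-1.
  by rewrite invfM invrK; ring.
by rewrite lef_pV2 ?posrE// mulr_gt0 ?invr_gt0 ?mulr_gt0.
Qed.

Lemma Sinv_LKT_gt0 y : 0 < Sinv (LKT K mu g) y.
Proof. by rewrite /Sinv invr_gt0 LKT_gt0. Qed.

Lemma Sinv_LKT_integrable : nu.-integrable setT (EFin \o Sinv (LKT K mu g)).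
Proof.
apply: (integrable_le_norm (g := fun y => 2 * Q * I^-1 * q y)) => //.
- exact: measurable_Sinv_LKT.
- move=> y _; rewrite ger0_norm ?(ltW (Sinv_LKT_gt0 _))//.
  by have /andP[] := Sinv_LKT_bounds y.
- exact: integrable_scaler.
Qed.

(** The upper bound integrates [2 * Q * I^-1 * q] against [nu], under which [q] has integral at most
    [2 * Q]; the lower bound only uses [B], which carries at least half of the mass of [nu]. *)
Lemma LK_Sinv_bounds x :
  (2 * Q * q x * I)^-1 <= LK K nu (Sinv (LKT K mu g)) x <= 4 * Q ^+ 2 * I^-1.
Proof.
set v := Sinv (LKT K mu g); have Iv : nu.-integrable _ _ := Sinv_LKT_integrable.
have vB : (2 * I)^-1 <= \int[nu]_(y in B) v y.
  apply: (@le_trans _ _ (\int[nu]_(y in B) (I^-1 * cst 1 y))).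
    rewrite RintegralZl//; last exact: (integrable_cstP nu (1 : R)).
    rewrite invfM mulrC ler_pM2l ?invr_gt0//.
  apply: le_Rintegral => //.
  - by apply: integrable_scaler => //; exact: (integrable_cstP nu (1 : R)).
  - exact: integrable_restr Iv.
  - by move=> y _; rewrite mulr1; have /andP[] := Sinv_LKT_bounds y.
have vT : \int[nu]_y v y <= 4 * Q ^+ 2 * I^-1.
  apply: (@le_trans _ _ (\int[nu]_y (2 * Q * I^-1 * q y))).
    apply: le_Rintegral => //; first exact: integrable_scaler.
    by move=> y _; have /andP[] := Sinv_LKT_bounds y.
  rewrite RintegralZl//.
  have -> : 4 * Q ^+ 2 * I^-1 = 2 * Q * I^-1 * (2 * Q) by ring.
  by rewrite ler_pM2l// mulr_gt0 ?invr_gt0 ?mulr_gt0.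
apply/andP; split; last first.
  apply: le_trans vT; apply: le_trans (ler_norm _) _.
  apply: le_trans (LK_le_norm mK K0 K1 x Iv) _.
  rewrite le_eqVlt; apply/orP; left; apply/eqP; apply: eq_Rintegral => y _.
  by rewrite ger0_norm// ltW// Sinv_LKT_gt0.
have -> : (2 * Q * q x * I)^-1 = (Q * q x)^-1 * (2 * I)^-1 - 0.
  by rewrite !invfM subr0; ring.
apply: (@LK_ge _ _ _ K nu B q Q) => //.
  by apply: nearW => y _; rewrite ltW// Sinv_LKT_gt0.
rewrite (_ : \int[nu]_(y in ~` B) _ = \int[nu]_(y in ~` B) 0).
  by rewrite Rintegral_cst// mul0r.
apply: eq_Rintegral => y _.
by rewrite /neg_part max_r// oppr_le0 ltW// Sinv_LKT_gt0.
Qed.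

Lemma LK_Sinv_gt0 x : 0 < LK K nu (Sinv (LKT K mu g)) x.
Proof.
have /andP[+ _] := LK_Sinv_bounds x; apply: lt_le_trans.
by rewrite invr_gt0 !mulr_gt0.
Qed.

Lemma sinkhorn_map_bounds x :
  (4 * Q ^+ 2)^-1 * I <= sinkhorn_map K mu nu g x <= 2 * Q * I * q x.
Proof.
have /andP[lo hi] := LK_Sinv_bounds x; have w0 := LK_Sinv_gt0 x.
rewrite /sinkhorn_map {1 3}/Sinv; apply/andP; split.
  rewrite -[I]invrK -invfM lef_pV2 ?posrE//.
  by rewrite mulr_gt0 ?invr_gt0// mulr_gt0// exprn_gt0.
have -> : 2 * Q * I * q x = ((2 * Q * q x * I)^-1)^-1 by rewrite invrK; ring.
by rewrite lef_pV2 ?posrE// invr_gt0 !mulr_gt0.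
Qed.

Lemma sinkhorn_map_gt0 x : 0 < sinkhorn_map K mu nu g x.
Proof. by rewrite /sinkhorn_map {1}/Sinv invr_gt0 LK_Sinv_gt0. Qed.

Lemma sinkhorn_map_L2 : L2 mu (sinkhorn_map K mu nu g).
Proof.
apply: (@L2_le_norm _ _ _ _ _ (fun x => 2 * Q * I * q x)).
- apply: measurable_fun_pos_inv => //; first exact: LK_Sinv_gt0.
  by apply: measurable_LK => //; exact: Sinv_LKT_integrable.
- move=> x; rewrite ger0_norm ?(ltW (sinkhorn_map_gt0 _))//.
  by have /andP[] := sinkhorn_map_bounds x.
- have q2 : L2 mu q by apply/L2P.
  have := L2_comb (2 * Q * I) 0 q2 q2; congr L2.
  by apply/funext => x; rewrite mul0r addr0.
Qed.

End OnePotential.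

Section TwoPotentials.
Variables g g' : X -> R.
Hypothesis Ig : mu.-integrable setT (EFin \o g).
Hypothesis g0 : {ae mu, forall x, 0 <= g x}.
Hypothesis gI : 0 < \int[mu]_x g x.
Hypothesis gB : \int[mu]_x g x <= 2 * \int[mu]_(x in B) g x.
Hypothesis Ig' : mu.-integrable setT (EFin \o g').
Hypothesis g'0 : {ae mu, forall x, 0 <= g' x}.
Hypothesis g'I : 0 < \int[mu]_x g' x.
Hypothesis g'B : \int[mu]_x g' x <= 2 * \int[mu]_(x in B) g' x.

(** [W] carries the scale of the pair: [s * s'] is bounded in terms of [W] and [v * v'] in terms of
    [W^-1]. It cancels in [bL], so the final bounds on the operator depend on [Q] and [lam] only. *)
Let W := (\int[mu]_x g x) * \int[mu]_x g' x.
Let W0 : 0 < W. Proof. exact: mulr_gt0. Qed.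

Let s := sinkhorn_map K mu nu g.
Let s' := sinkhorn_map K mu nu g'.
Let v := Sinv (LKT K mu g).
Let v' := Sinv (LKT K mu g').

Let s_gt0 x : 0 < s x. Proof. exact: sinkhorn_map_gt0. Qed.
Let s'_gt0 x : 0 < s' x. Proof. exact: sinkhorn_map_gt0. Qed.
Let v_gt0 x : 0 < v x. Proof. exact: Sinv_LKT_gt0. Qed.
Let v'_gt0 x : 0 < v' x. Proof. exact: Sinv_LKT_gt0. Qed.

Let a_bounds x :
  P ^+ 4 / 16 * W <= s x * s' x <= 4 * Q ^+ 2 * W * q x ^+ 2.
Proof.
have /andP[l u] := sinkhorn_map_bounds Ig g0 gI gB x.
have /andP[l' u'] := sinkhorn_map_bounds Ig' g'0 g'I g'B x.
apply/andP; split.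
  apply: le_trans (ler_pM _ _ l l'); last 2 first.
  - by rewrite mulr_ge0 ?invr_ge0 ?(ltW gI)// mulr_ge0// exprn_ge0// ltW.
  - by rewrite mulr_ge0 ?invr_ge0 ?(ltW g'I)// mulr_ge0// exprn_ge0// ltW.
  rewrite /W le_eqVlt; apply/orP; left; apply/eqP.
  by rewrite /P; field; rewrite gt_eqF.
apply: le_trans (ler_pM (ltW (s_gt0 x)) (ltW (s'_gt0 x)) u u') _.
by rewrite /W le_eqVlt; apply/orP; left; apply/eqP; ring.
Qed.

Let b_bounds y : W^-1 <= v y * v' y <= 4 * Q ^+ 2 * W^-1 * q y ^+ 2.
Proof.
have /andP[l u] := Sinv_LKT_bounds Ig g0 gI gB y.
have /andP[l' u'] := Sinv_LKT_bounds Ig' g'0 g'I g'B y.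
apply/andP; split.
  apply: le_trans (ler_pM _ _ l l'); first by rewrite /W invfM.
  - by rewrite invr_ge0 ltW.
  - by rewrite invr_ge0 ltW.
apply: le_trans (ler_pM (ltW (v_gt0 y)) (ltW (v'_gt0 y)) u u') _.
by rewrite /W invfM le_eqVlt; apply/orP; left; apply/eqP; ring.
Qed.

(** For [k] in the cone F, [lam] will be the integral of [k], which is comparable to the mass of [k]
    in [B] because the tails are small. *)
Variables (k : X -> R) (lam : R).
Hypothesis k2 : L2 mu k.
Hypothesis kB : {ae mu, forall x, B x -> 0 <= k x}.
Hypothesis lamk : lam / 2 <= \int[mu]_(x in B) k x <= 2 * lam.
Hypothesis Ikq : mu.-integrable setT (EFin \o (fun x => `|k x| * q x ^+ 2)).
Hypothesis ktau : \int[mu]_(x in ~` B) (`|k x| * q x ^+ 2) <= 2 * tau * lam.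

Let lam0 : 0 <= lam.
Proof. by move: lamk => /andP[]; lra. Qed.

Let ka x := k x * (s x * s' x).
Let L := LKT K mu ka.
Let bL y := v y * v' y * L y.

Let ms : measurable_fun setT s.
Proof. by have [] : L2 mu s by exact: sinkhorn_map_L2. Qed.

Let ms' : measurable_fun setT s'.
Proof. by have [] : L2 mu s' by exact: sinkhorn_map_L2. Qed.

Let ka_le x : `|ka x| <= 4 * Q ^+ 2 * W * (`|k x| * q x ^+ 2).
Proof.
have /andP[_ h] := a_bounds x.
rewrite /ka normrM (ger0_norm (ltW (mulr_gt0 (s_gt0 x) (s'_gt0 x)))).
by rewrite [leRHS]mulrCA; exact: ler_wpM2l.
Qed.

Let Ika : mu.-integrable setT (EFin \o ka).
Proof.
apply: (integrable_le_norm (g := fun x => 4 * Q ^+ 2 * W * (`|k x| * q x ^+ 2))) => //.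
- by apply: measurable_funM; [case: k2|exact: measurable_funM].
- exact: integrable_scaler.
Qed.

Let c0 : 0 <= 4 * Q ^+ 2 * W.
Proof. by rewrite !mulr_ge0 ?exprn_ge0 ?ltW. Qed.

Let ka_tail : \int[mu]_(x in ~` B) `|ka x| <= 4 * Q ^+ 2 * W * (2 * tau * lam).
Proof.
apply: le_trans (ler_wpM2l c0 ktau).
rewrite -RintegralZl//; last exact: integrable_restr Ikq.
apply: le_Rintegral => //.
- by apply: integrable_restr => //; exact: integrable_norm Ika.
- by apply: integrable_scaler => //; exact: integrable_restr Ikq.
Qed.

Let neg_part_le_norm (rho : probability X R) f :
  rho.-integrable setT (EFin \o f) ->
  \int[rho]_(x in ~` B) neg_part f x <= \int[rho]_(x in ~` B) `|f x|.
Proof.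
move=> If; have h x : 0 <= neg_part f x <= `|f x|.
  rewrite /neg_part le_max lexx orbT/= /Num.max; case: ifP => _ //.
  by rewrite -normrN ler_norm.
have In : rho.-integrable (~` B) (EFin \o (Num.norm \o f)).
  by apply: integrable_restr => //; exact: integrable_norm.
apply: le_Rintegral => //; last by move=> x _; have /andP[] := h x.
apply: (integrable_le_norm (g := Num.norm \o f)) => //.
  apply: measurable_maxr => //; apply: measurableT_comp => //.
  exact: (integrable_measurable (integrable_restr mCB If)).
by move=> x _; have /andP[h0 h1] := h x; rewrite ger0_norm.
Qed.

(** The main term P^6 / 32 collects P^2 from the kernel, P^4 / 16 from [s * s'] and 1/2 from [lamk];
    the tail costs 8 Q^2 tau, far less than half of it. *)
Let L_ge y : B y -> P ^+ 6 / 64 * W * lam <= L y.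
Proof.
move=> By; rewrite /L LKT_flip.
have : (Q * q y)^-1 * (P ^+ 4 / 16 * W * (lam / 2)) -
    4 * Q ^+ 2 * W * (2 * tau * lam) <= LK (fun y x => K x y) mu ka y.
  apply: (@LK_ge _ _ _ _ mu B q Q) => //.
  - exact: measurable_kernel_flip.
  - by move=> x z; rewrite mulrC.
  - by apply: filterS kB => x kx Bx; rewrite mulr_ge0 ?kx// mulr_ge0 ?ltW.
  - have h0 : 0 <= P ^+ 4 / 16 * W by rewrite !mulr_ge0 ?exprn_ge0 ?ltW.
    move: lamk => /andP[lk _]; apply: le_trans (ler_wpM2l h0 lk) _.
    rewrite -RintegralZl//; last exact: integrable_restr (L2_integrable k2).
    apply: ae_le_Rintegral => //.
    + by apply: integrable_scaler => //; exact: integrable_restr (L2_integrable k2).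
    + exact: integrable_restr Ika.
    + apply: filterS kB => x kx Bx; rewrite mulrC; apply: ler_wpM2l; first exact: kx.
      by have /andP[] := a_bounds x.
  - exact: le_trans (neg_part_le_norm Ika) ka_tail.
apply: le_trans.
rewrite (qB By) invfM -/P.
have -> : P * P * (P ^+ 4 / 16 * W * (lam / 2)) = P ^+ 6 / 32 * (W * lam) by field.
have -> : 4 * Q ^+ 2 * W * (2 * tau * lam) = 8 * (Q ^+ 2 * tau) * (W * lam) by ring.
rewrite -mulrA -mulrBl; apply: ler_wpM2r; first by rewrite mulr_ge0// ltW.
have := exprn_gt0 6 P0; move: Q2tau; lra.
Qed.

Let L_le y : `|L y| <= 16 * Q ^+ 4 * W * lam.
Proof.
apply: (@le_trans _ _ (\int[mu]_x `|ka x|)).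
  rewrite /L LKT_flip; apply: LK_le_norm => //; exact: measurable_kernel_flip.
rewrite (Rintegral_split mB (integrable_norm Ika)).
have kaB : \int[mu]_(x in B) `|ka x| <= 4 * Q ^+ 2 * W * Q ^+ 2 * (2 * lam).
  move: lamk => /andP[_ lk].
  have h0 : 0 <= 4 * Q ^+ 2 * W * Q ^+ 2 by rewrite mulr_ge0// exprn_ge0// ltW.
  apply: le_trans (ler_wpM2l h0 lk).
  rewrite -RintegralZl//; last exact: integrable_restr (L2_integrable k2).
  apply: ae_le_Rintegral => //.
  - by apply: integrable_restr => //; exact: integrable_norm Ika.
  - by apply: integrable_scaler => //; exact: integrable_restr (L2_integrable k2).
  - apply: filterS kB => x kx Bx; apply: le_trans (ka_le x) _.
    rewrite (qB Bx) (ger0_norm (kx Bx)) le_eqVlt.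
    by apply/orP; left; apply/eqP; ring.
apply: le_trans (lerD kaB ka_tail) _.
have -> : 4 * Q ^+ 2 * W * Q ^+ 2 * (2 * lam) + 4 * Q ^+ 2 * W * (2 * tau * lam) =
  8 * Q ^+ 2 * (Q ^+ 2 + tau) * (W * lam) by ring.
have -> : 16 * Q ^+ 4 * W * lam = 8 * Q ^+ 2 * (2 * Q ^+ 2) * (W * lam) by ring.
apply: ler_wpM2r; first by rewrite mulr_ge0// ltW.
apply: ler_wpM2l; first by rewrite mulr_ge0// exprn_ge0// ltW.
have : 1 <= Q ^+ 2 by rewrite exprn_ege1.
move: tau_half; lra.
Qed.

Let mv : measurable_fun setT v. Proof. exact: measurable_Sinv_LKT. Qed.
Let mv' : measurable_fun setT v'. Proof. exact: measurable_Sinv_LKT. Qed.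

Let bL_le y : `|bL y| <= 64 * Q ^+ 6 * lam * q y ^+ 2.
Proof.
have /andP[_ h] := b_bounds y.
rewrite /bL normrM (ger0_norm (ltW (mulr_gt0 (v_gt0 y) (v'_gt0 y)))).
apply: le_trans (ler_pM _ _ h (L_le y)) _ => //.
  by rewrite ltW// mulr_gt0.
rewrite le_eqVlt; apply/orP; left; apply/eqP; field.
by rewrite gt_eqF.
Qed.

Let IbL : nu.-integrable setT (EFin \o bL).
Proof.
apply: (integrable_le_norm (g := fun y => 64 * Q ^+ 6 * lam * q y ^+ 2)) => //.
- by apply: measurable_funM; [exact: measurable_funM|exact: measurable_LKT].
- exact: integrable_scaler.
Qed.

(* With u := LKT g, w := LK (1/u), and u', w' for g', this is
   k |-> LK ((u u')^-1 LKT (k / (w w'))). Two applications of Fubini give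
   int (k / w) = int (op k) g and int (k / w') = int (op k) g', so that the
   nonlinear Sinkhorn step acts on ratios of integrals like a positive linear
   operator. *)
Definition sinkhorn_op := LK K nu bL.

Lemma measurable_sinkhorn_op : measurable_fun setT sinkhorn_op.
Proof. exact: measurable_LK. Qed.

Let c1 : 0 <= 64 * Q ^+ 6 * lam.
Proof. by rewrite !mulr_ge0 ?exprn_ge0 ?(ltW Q0). Qed.

Lemma sinkhorn_op_ge z : B z -> P ^+ 8 / 256 * lam <= sinkhorn_op z.
Proof.
move=> Bz.
have bL_ge y : B y -> P ^+ 6 / 64 * lam <= bL y.
  move=> By; have /andP[h _] := b_bounds y.
  have -> : P ^+ 6 / 64 * lam = W^-1 * (P ^+ 6 / 64 * W * lam).
    by field; rewrite gt_eqF.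
  apply: ler_pM (L_ge By) => //; first by rewrite invr_ge0 ltW.
  apply: mulr_ge0 => //; apply: mulr_ge0; last exact: ltW.
  by rewrite divr_ge0 ?exprn_ge0 ?(ltW P0).
have h0 : 0 <= P ^+ 6 / 64 * lam by rewrite !mulr_ge0 ?exprn_ge0 ?(ltW P0).
have : (Q * q z)^-1 * (P ^+ 6 / 64 * lam * 2^-1) - 64 * Q ^+ 6 * lam * tau
    <= sinkhorn_op z.
  apply: (@LK_ge _ _ _ _ nu B q Q) => //.
  - by apply: nearW => y By; exact: le_trans h0 (bL_ge y By).
  - apply: le_trans (ler_wpM2l h0 nuB) _.
    rewrite -RintegralZl//; last exact: (integrable_cstP nu (1 : R)).
    apply: le_Rintegral => //.
    + by apply: integrable_scaler => //; exact: (integrable_cstP nu (1 : R)).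
    + exact: integrable_restr IbL.
    + by move=> y By; rewrite mulr1 bL_ge.
  - apply: le_trans (neg_part_le_norm IbL) _.
    apply: le_trans (ler_wpM2l c1 nutau).
    rewrite -RintegralZl//; last exact: integrable_restr nuq.
    apply: le_Rintegral => //.
    + by apply: integrable_restr => //; exact: integrable_norm IbL.
    + by apply: integrable_scaler => //; exact: integrable_restr nuq.
apply: le_trans.
rewrite (qB Bz) invfM -/P.
have -> : 64 * Q ^+ 6 * lam * tau = 64 * (Q ^+ 6 * tau) * lam by ring.
rewrite Q6tau.
have -> : P * P * (P ^+ 6 / 64 * lam * 2^-1) - 64 * (P ^+ 8 / 2 ^+ 14) * lam =
  P ^+ 8 / 256 * lam by field.
by [].
Qed.

Lemma sinkhorn_op_le z : `|sinkhorn_op z| <= 128 * Q ^+ 8 * lam.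
Proof.
apply: le_trans (LK_le_norm mK K0 K1 z IbL) _.
apply: (@le_trans _ _ (\int[nu]_y (64 * Q ^+ 6 * lam * q y ^+ 2))).
  by apply: le_Rintegral => //; [exact: integrable_norm IbL|exact: integrable_scaler].
rewrite RintegralZl//; apply: le_trans (ler_wpM2l c1 nuq2) _.
by rewrite le_eqVlt; apply/orP; left; apply/eqP; ring.
Qed.

Lemma sinkhorn_op_adjoint :
  (\int[mu]_x (k x * s x) = \int[mu]_x (sinkhorn_op x * g x)) /\
  (\int[mu]_x (k x * s' x) = \int[mu]_x (sinkhorn_op x * g' x)).
Proof.
have IvT := Sinv_LKT_integrable Ig g0 gI gB.
have Iv'T := Sinv_LKT_integrable Ig' g'0 g'I g'B.
have adj f : mu.-integrable setT (EFin \o f) ->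
    \int[mu]_x (sinkhorn_op x * f x) = \int[nu]_y (LKT K mu f y * bL y).
  move=> If; under eq_Rintegral do rewrite mulrC.
  by rewrite -(LK_duality mK K0 K1 If IbL).
split; rewrite adj//.
(* Here [s] is expanded as [s * s' * LK K nu v']; after duality [v'] is expanded as
   [v * v' * LKT K mu g]. For [g'] the roles are exchanged. *)
- transitivity (\int[mu]_x (ka x * LK K nu v' x)).
    apply: eq_Rintegral => x _; rewrite /ka -!mulrA.
    rewrite (_ : s' x * LK K nu v' x = 1) ?mulr1//.
    by rewrite mulVf// gt_eqF// LK_Sinv_gt0.
  rewrite (LK_duality mK K0 K1 Ika Iv'T); apply: eq_Rintegral => y _.
  have uv : LKT K mu g y * v y = 1 by rewrite mulfV// gt_eqF// LKT_gt0.
  by rewrite -[Sinv (LKT K mu g')]/v' /bL /L -[LHS]mul1r -uv; ring.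
- transitivity (\int[mu]_x (ka x * LK K nu v x)).
    apply: eq_Rintegral => x _; rewrite /ka (mulrC (s x)) -!mulrA.
    rewrite (_ : s x * LK K nu v x = 1) ?mulr1//.
    by rewrite mulVf// gt_eqF// LK_Sinv_gt0.
  rewrite (LK_duality mK K0 K1 Ika IvT); apply: eq_Rintegral => y _.
  have uv : LKT K mu g' y * v' y = 1 by rewrite mulfV// gt_eqF// LKT_gt0.
  by rewrite -[Sinv (LKT K mu g)]/v /bL /L -[LHS]mul1r -uv; ring.
Qed.

End TwoPotentials.

End SinkhornBounds.

(** * Birkhoff contraction *)

Section Birkhoff.
Context {R : realType}.
Implicit Types x y s S A p m M : R.

Lemma is_derive_ln_affine (p p' x : R) : 0 < p * x + p' ->
  is_derive x 1 (fun t => ln (p * t + p')) (p / (p * x + p')).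
Proof.
move=> h.
have dl : is_derive x 1 (fun t => p * t + p') p.
  have -> : (fun t => p * t + p') = (p \*: @id R) + cst p' by [].
  by apply: is_derive_eq; rewrite addr0 /GRing.scale /= mulr1.
have := @is_derive1_comp _ (@ln R) (fun t => p * t + p') x _ _ (is_derive1_ln h) dl.
by rewrite mulrC.
Qed.

(** As a function of ln x the left side has the slope bounded in the last hypothesis; the mean value
    theorem on [1, x] integrates this bound. *)
Lemma ln_affine_ratio_le (kappa p p' r r' x : R) : 1 <= x ->
  0 <= p -> 0 <= p' -> 0 <= r -> 0 <= r' -> 0 < p + p' -> 0 < r + r' ->
  (forall y, 0 < y -> p * y / (p * y + p') - r * y / (r * y + r') <= kappa) ->
  ln (p * x + p') - ln (r * x + r') - (ln (p + p') - ln (r + r')) <= kappa * ln x.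
Proof.
move=> x1 p0 p'0 r0 r'0 pp rr H.
have pos (a b y : R) : 0 <= a -> 0 <= b -> 0 < a + b -> 0 < y -> 0 < a * y + b.
  move=> a0 b0 ab y0; rewrite le_eqVlt in a0; case/predU1P : a0 => [a0|a0].
    by rewrite -a0 mul0r add0r; rewrite -a0 add0r in ab.
  by rewrite ltr_wpDr// mulr_gt0.
pose f t := kappa * ln t - ln (p * t + p') + ln (r * t + r').
pose df t := kappa * t^-1 - p / (p * t + p') + r / (r * t + r').
have dF (t : R) : 0 < t -> is_derive t 1 f (df t).
  move=> t0.
  have d1 := is_derive1_ln t0.
  have d2 := is_derive_ln_affine (pos _ _ _ p0 p'0 pp t0).
  have d3 := is_derive_ln_affine (pos _ _ _ r0 r'0 rr t0).
  have -> : f = (kappa \*: @ln R) - (fun t => ln (p * t + p')) +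
    (fun t => ln (r * t + r')) by [].
  by apply: is_derive_eq.
have x0 : 0 < x by exact: lt_le_trans x1.
have [||c /[!in_itv]/= /andP[c1 _]] := @MVT_segment R f df 1 x x1.
- by move=> t /[!in_itv]/= /andP[t1 _]; apply: dF; exact: lt_trans t1.
- apply: derivable_within_continuous => t /[!in_itv]/= /andP[t1 _].
  by apply: (@ex_derive _ _ _ _ _ _ _ (dF t _)); exact: lt_le_trans t1.
have c0 : 0 < c by exact: lt_le_trans c1.
have : 0 <= df c.
  have -> : df c = (kappa - (p * c / (p * c + p') - r * c / (r * c + r'))) / c.
    by rewrite /df; field; rewrite !gt_eqF// pos.
  by rewrite divr_ge0 ?(ltW c0)// subr_ge0 H.
move=> dfc; rewrite /f !mulr1 ln1 mulr0 => E.
have : 0 <= df c * (x - 1) by rewrite mulr_ge0// subr_ge0.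
rewrite -E; lra.
Qed.

(** The slope is a difference of two fractions. If [A * y <= A'] the first is at most [S / (S + s)];
    otherwise the second is at least [s / (S + s)] and the first at most 1. Birkhoff's sharp
    constant is [(S - s) / (S + s)]; the cruder one is still below 1. *)
Lemma ln_cross_ratio_le s S A A' x : 0 < s -> s <= S -> 0 <= A -> 0 <= A' ->
  0 < A + A' -> 1 <= x ->
  ln (S * A * x + s * A') - ln (s * A * x + S * A') -
    (ln (S * A + s * A') - ln (s * A + S * A')) <= S / (S + s) * ln x.
Proof.
move=> s0 sS A0 A'0 AA x1.
have S0 : 0 < S by exact: lt_le_trans sS.
have pos (a b : R) : 0 < a -> 0 < b -> 0 < a * A + b * A'.
  move=> a0 b0; move: A0; rewrite le_eqVlt => /predU1P[E|A0].
    by move: AA; rewrite -E add0r mulr0 add0r => A'p; rewrite mulr_gt0.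
  by rewrite ltr_wpDr ?mulr_gt0// mulr_ge0// ltW.
apply: ln_affine_ratio_le => //.
- by rewrite mulr_ge0// ltW.
- by rewrite mulr_ge0// ltW.
- by rewrite mulr_ge0// ltW.
- by rewrite mulr_ge0// ltW.
- exact: pos.
- exact: pos.
move=> y y0.
have Ay0 : 0 <= A * y by rewrite mulr_ge0// ltW.
have D1 : 0 < S * A * y + s * A'.
  move: A0; rewrite le_eqVlt => /predU1P[E|A0].
    by move: AA; rewrite -E add0r mulr0 mul0r add0r => A'p; rewrite mulr_gt0.
  by rewrite ltr_wpDr ?mulr_gt0// mulr_ge0// ltW.
have D2 : 0 < s * A * y + S * A'.
  have : s * (S * A * y + s * A') <= S * (s * A * y + S * A').
    have : s * s * A' <= S * S * A' by apply: ler_wpM2r => //; nra.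
    lra.
  move=> h; rewrite -(pmulr_rgt0 _ S0); apply: lt_le_trans h.
  exact: mulr_gt0.
have Ss : 0 < S + s by rewrite addr_gt0.
have [yA|yA] := leP (A * y) A'.
  have h2 : 0 <= s * A * y / (s * A * y + S * A').
    by rewrite divr_ge0 ?(ltW D2)// -mulrA mulr_ge0// ltW.
  suff : S * A * y / (S * A * y + s * A') <= S / (S + s) by lra.
  rewrite ler_pdivrMr// [leRHS]mulrAC ler_pdivlMr//.
  have : S * s * (A * y) <= S * s * A' by apply: ler_wpM2l => //; nra.
  lra.
have h1 : S * A * y / (S * A * y + s * A') <= 1.
  by rewrite ler_pdivrMr// mul1r lerDl mulr_ge0// ltW.
suff : s / (S + s) <= s * A * y / (s * A * y + S * A').
  have : S / (S + s) + s / (S + s) = 1 by rewrite -mulrDl divff// gt_eqF.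
  lra.
rewrite ler_pdivrMr// [leRHS]mulrAC ler_pdivlMr//.
have : S * s * A' <= S * s * (A * y) by apply: ler_wpM2l; [nra|exact: ltW].
lra.
Qed.

(* The extreme slopes n / n' on the cone of positive (n, n') whose coordinates
   p = n - m n' and p' = M n' - n are comparable, up to the factors s and S,
   with those of a fixed vector. *)
Lemma birkhoff_slopes m M s S A A' : 0 < m -> m <= M -> 0 < s -> s <= S ->
  0 <= A -> 0 <= A' -> (M = m \/ 0 < A + A') ->
  exists mh Mh : R, [/\ 0 < mh, 0 < Mh,
    ln (Mh / mh) <= S / (S + s) * ln (M / m) &
    forall n n' lam : R, 0 <= lam ->
      s * lam * A <= n - m * n' <= S * lam * A ->
      s * lam * A' <= M * n' - n <= S * lam * A' ->
      mh * n' <= n /\ n <= Mh * n'].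
Proof.
move=> m0 mM s0 sS A0 A'0 [E|AA].
  (* For [M = m] the two differences are opposite and both nonnegative, so [n = m * n']. This case
     is separate because [A + A'] may vanish in it. *)
  exists m, m; rewrite E !divff ?gt_eqF// ln1 mulr0; split => // n n' lam lam0.
  move=> /andP[h1 _] /andP[h2 _].
  have : 0 <= s * lam * A by rewrite !mulr_ge0// ltW.
  have : 0 <= s * lam * A' by rewrite !mulr_ge0// ltW.
  by split; lra.
have S0 : 0 < S by exact: lt_le_trans sS.
have M0 : 0 < M by exact: lt_le_trans mM.
have pos (a b : R) : 0 < a -> 0 < b -> 0 < a * A + b * A'.
  move=> a0 b0; move: A0; rewrite le_eqVlt => /predU1P[E|A0].
    by move: AA; rewrite -E add0r mulr0 add0r => A'p; rewrite mulr_gt0.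
  by rewrite ltr_wpDr ?mulr_gt0// mulr_ge0// ltW.
have u1 := pos _ _ (mulr_gt0 M0 S0) (mulr_gt0 m0 s0).
have u2 := pos _ _ S0 s0.
have l1 := pos _ _ (mulr_gt0 M0 s0) (mulr_gt0 m0 S0).
have l2 := pos _ _ s0 S0.
(* With a = n - m n' and a' = M n' - n, and m < M, the slope n / n' equals (M a + m a') / (a + a'),
   which increases with a / a'. The witnesses are its values at the extreme ratios s A / (S A') and
   S A / (s A'). *)
exists ((M * s * A + m * S * A') / (s * A + S * A')).
exists ((M * S * A + m * s * A') / (S * A + s * A')).
split; [exact: divr_gt0|exact: divr_gt0| |].
- have x1 : 1 <= M / m by rewrite ler_pdivlMr// mul1r.
  apply: le_trans (ln_cross_ratio_le s0 sS A0 A'0 AA x1).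
  have e1 : M * S * A + m * s * A' = m * (S * A * (M / m) + s * A').
    by field; rewrite gt_eqF.
  have e2 : M * s * A + m * S * A' = m * (s * A * (M / m) + S * A').
    by field; rewrite gt_eqF.
  have p1 : 0 < S * A * (M / m) + s * A' by rewrite -(pmulr_rgt0 _ m0) -e1.
  have p2 : 0 < s * A * (M / m) + S * A' by rewrite -(pmulr_rgt0 _ m0) -e2.
  rewrite ln_div ?posrE ?divr_gt0// !ln_div ?posrE// e1 e2 !lnM ?posrE//.
  lra.
- move=> n n' lam lam0 /andP[h1 h2] /andP[h3 h4]; split.
  + rewrite mulrAC ler_pdivrMr//.
    have i1 : s * A * (M * n' - n) <= s * A * (S * lam * A').
      by rewrite ler_wpM2l// mulr_ge0// ltW.
    have i2 : S * A' * (s * lam * A) <= S * A' * (n - m * n').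
      by rewrite ler_wpM2l// mulr_ge0// ltW.
    lra.
  + rewrite mulrAC ler_pdivlMr//.
    have i1 : S * A * (s * lam * A') <= S * A * (M * n' - n).
      by rewrite ler_wpM2l// mulr_ge0// ltW.
    have i2 : s * A' * (n - m * n') <= s * A' * (S * lam * A).
      by rewrite ler_wpM2l// mulr_ge0// ltW.
    lra.
Qed.

End Birkhoff.

(** * Hilbert's metric of the dual cone *)

Section HilbertContraction.
Context {R : realType} {d : measure_display} {X : measurableType d}.
Variables (dX : X -> X -> R) (x0 : X) (m1 m2 : R) (alpha alpha' : R -> R).
Variable mu : probability X R.
Let F := coneF dX x0 m1 m2 alpha alpha' mu.
Let C := coneG dX x0 m1 m2 alpha alpha' mu.
Implicit Types f g h k T : X -> R.

Lemma coneF_L2 f : F f -> L2 mu f. Proof. by case. Qed.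

Lemma Rintegral_mul_comb f g h (a b : R) : L2 mu f -> L2 mu g -> L2 mu h ->
  \int[mu]_x (f x * (a * g x - b * h x)) =
  a * \int[mu]_x (f x * g x) - b * \int[mu]_x (f x * h x).
Proof.
move=> f2 g2 h2.
have Ig := L2_mul_integrable f2 g2; have Ih := L2_mul_integrable f2 h2.
rewrite -!RintegralZl// -RintegralB//; try exact: integrable_scaler.
by apply: eq_Rintegral => x _; ring.
Qed.

Lemma coneG_subP g g' (b : R) : L2 mu g -> L2 mu g' ->
  C (b \*o g' \- g) <->
  forall f, F f -> \int[mu]_x (f x * g x) <= b * \int[mu]_x (f x * g' x).
Proof.
move=> g2 g'2.
have E f : F f -> \int[mu]_x (f x * (b \*o g' \- g) x) =
    b * \int[mu]_x (f x * g' x) - \int[mu]_x (f x * g x).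
  move=> /coneF_L2 f2; rewrite -[X in _ - X]mul1r -Rintegral_mul_comb//.
  by apply: eq_Rintegral => x _ /=; rewrite mul1r.
split=> [[_ h] f Ff|h]; first by rewrite -subr_ge0 -E// h.
split=> [|f Ff]; last by rewrite E// subr_ge0 h.
have := L2_comb b (-1) g'2 g2; congr (L2 _ _).
by apply/funext => x /=; rewrite mulN1r.
Qed.

Lemma coneG_subP' g g' (a : R) : L2 mu g -> L2 mu g' ->
  C (g \- a \*o g') <->
  forall f, F f -> a * \int[mu]_x (f x * g' x) <= \int[mu]_x (f x * g x).
Proof.
move=> g2 g'2.
have E f : F f -> \int[mu]_x (f x * (g \- a \*o g') x) =
    \int[mu]_x (f x * g x) - a * \int[mu]_x (f x * g' x).
  move=> /coneF_L2 f2; rewrite -[X in X - _]mul1r -Rintegral_mul_comb//.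
  by apply: eq_Rintegral => x _ /=; rewrite mul1r.
split=> [[_ h] f Ff|h]; first by rewrite -subr_ge0 -E// h.
split=> [|f Ff]; last by rewrite E// subr_ge0 h.
have := L2_comb 1 (- a) g2 g'2; congr (L2 _ _).
by apply/funext => x /=; rewrite mul1r mulNr.
Qed.

Lemma hilbM_le g g' (b : R) : 0 < b -> C (b \*o g' \- g) -> hilbM C g g' <= b.
Proof. by move=> b0 Cb; apply: ge_inf => //; exists 0 => y [/ltW]. Qed.

Lemma ln_hilb_ratio_le g g' (a b : R) : 0 < a -> 0 < b ->
  C (g \- a \*o g') -> C (b \*o g' \- g) -> 1 <= b / a ->
  ln (hilbM C g g' / hilbm C g g') <= ln (b / a).
Proof.
move=> a0 b0 Ca Cb ab.
have Mb := hilbM_le b0 Cb.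
have M0 : 0 <= hilbM C g g'.
  by apply: lb_le_inf; [exists b|move=> y [/ltW]].
(* sup is 0 on sets without supremum, and ln 0 = 0 *)
have [hs|ns] := pselect (has_sup [set a : R | 0 < a /\ C (g \- a \*o g')]); last first.
  by rewrite /hilbm sup_out// invr0 mulr0 ln0// ln_ge0.
have am : a <= hilbm C g g' by apply: ub_le_sup => //; case: hs.
have m0 : 0 < hilbm C g g' by exact: lt_le_trans am.
move: M0; rewrite le_eqVlt => /predU1P[<-|M0].
  by rewrite mul0r ln0// ln_ge0.
rewrite ler_ln ?posrE ?divr_gt0//.
apply: ler_pM => //; [exact: ltW|by rewrite invr_ge0 ltW|].
by rewrite lef_pV2 ?posrE.
Qed.

Variables (s S : R) (g g' h h' : X -> R).
Hypothesis s0 : 0 < s.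
Hypothesis sS : s <= S.
Hypothesis F1 : F (cst 1).
Hypothesis Cg : C g.
Hypothesis Cg' : C g'.
Hypothesis gI : 0 < \int[mu]_x g x.
Hypothesis g'I : 0 < \int[mu]_x g' x.
Hypothesis h2 : L2 mu h.
Hypothesis h'2 : L2 mu h'.
Hypothesis h'nz : ~ ae_zero mu h'.
(** [T] and [lam] are chosen after [k], since slopes are estimated for one test function at a time.
    The two memberships place [T] between [s * lam] and [S * lam] in the order of F, so the images
    have projective diameter at most 2 ln (S / s). *)
Hypothesis op : forall k, F k -> exists T lam, [/\ 0 <= lam, L2 mu T,
  F (fun x => T x - s * lam) /\ F (fun x => S * lam - T x),
  \int[mu]_x (k x * h x) = \int[mu]_x (T x * g x) &
  \int[mu]_x (k x * h' x) = \int[mu]_x (T x * g' x)].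

Let g2 : L2 mu g. Proof. by case: Cg. Qed.
Let g'2 : L2 mu g'. Proof. by case: Cg'. Qed.

Let N f := \int[mu]_x (f x * g x).
Let N' f := \int[mu]_x (f x * g' x).

Lemma hilbert_metric_contraction :
  (hilbert_metric mu C h h' <= (S / (S + s))%:E * hilbert_metric mu C g g')%E.
Proof.
have kappa0 : 0 < S / (S + s).
  have S0 := lt_le_trans s0 sS; by rewrite divr_gt0// addr_gt0.
rewrite [in leRHS]/hilbert_metric; case: asboolP => [[[[b b0 Cb] [b' b'0 Cb']] _]|_];
  last by rewrite gt0_muley ?leey// lte_fin.
have N1 : N (cst 1) = \int[mu]_x g x.
  by apply: eq_Rintegral => x _; rewrite mul1r.
have N'1 : N' (cst 1) = \int[mu]_x g' x.
  by apply: eq_Rintegral => x _; rewrite mul1r.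
set M := hilbM C g g'; set m := hilbm C g g'.
have ge0N f : F f -> 0 <= N f by case: Cg => _; apply.
have ge0N' f : F f -> 0 <= N' f by case: Cg' => _; apply.
(* The infimum passes to the inequality after division by [N' f]. If [N' f = 0], the single
   admissible [b] already gives [N f <= 0]. *)
have NM f : F f -> N f <= M * N' f.
  move=> Ff; have := ge0N' _ Ff; rewrite le_eqVlt => /predU1P[E|Nf].
    have := (coneG_subP b g2 g'2).1 Cb f Ff.
    by rewrite -/(N f) -/(N' f) -E !mulr0.
  rewrite -ler_pdivrMr//; apply: lb_le_inf; first by exists b.
  move=> y [_ /(coneG_subP y g2 g'2) /(_ f Ff) ?].
  by rewrite ler_pdivrMr.
have a0 : 0 < b'^-1 by rewrite invr_gt0.
have Ca : C (g \- b'^-1 \*o g').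
  apply/coneG_subP' => // f Ff; rewrite ler_pdivrMl//.
  exact: (coneG_subP b' g'2 g2).1.
have mub (f : X -> R) : F f -> 0 < N' f ->
    ubound [set a : R | 0 < a /\ C (g \- a \*o g')] (N f / N' f).
  move=> Ff Nf y [_ /(coneG_subP' y g2 g'2) /(_ f Ff) ?].
  by rewrite ler_pdivlMr.
have Nm f : F f -> m * N' f <= N f.
  move=> Ff; have := ge0N' _ Ff; rewrite le_eqVlt => /predU1P[E|Nf].
    by rewrite -E mulr0 ge0N.
  by rewrite -ler_pdivlMr//; apply: ge_sup; [exists b'^-1|exact: mub].
(* The constant test function 1 bounds the admissible factors from above, so [m] is a genuine
   supremum and not the default value 0. *)
have m0 : 0 < m.
  apply: (lt_le_trans a0); apply: (ub_le_sup _ (conj a0 Ca)).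
  by exists (N (cst 1) / N' (cst 1)); apply: mub; rewrite // N'1.
have mM : m <= M.
  by have := le_trans (Nm _ F1) (NM _ F1); rewrite N'1 ler_pM2r.
(* The fixed vector of [birkhoff_slopes] is the constant 1. Its hypotheses follow from the
   positivity of [N - m N'] and [M N' - N] on F, applied to [T - s * lam] and [S * lam - T]. *)
pose A := N (cst 1) - m * N' (cst 1); pose A' := M * N' (cst 1) - N (cst 1).
have A0 : 0 <= A by rewrite subr_ge0 Nm.
have A'0 : 0 <= A' by rewrite subr_ge0 NM.
have AA : M = m \/ 0 < A + A'.
  move: mM; rewrite le_eqVlt => /predU1P[->|mM]; [by left|right].
  have -> : A + A' = (M - m) * N' (cst 1) by rewrite /A /A'; ring.
  by rewrite N'1 mulr_gt0// subr_gt0.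
have [mh [Mh [mh0 Mh0 Hln Hslope]]] := birkhoff_slopes m0 mM s0 sS A0 A'0 AA.
have slopes k : F k -> mh * \int[mu]_x (k x * h' x) <= \int[mu]_x (k x * h x) /\
    \int[mu]_x (k x * h x) <= Mh * \int[mu]_x (k x * h' x).
  move=> Fk; have [T [lam [lam0 T2 [Fl Fu] -> ->]]] := op Fk.
  have lin (f : X -> R) (a : R) : L2 mu f ->
      \int[mu]_x ((T x - a) * f x) =
      \int[mu]_x (T x * f x) - a * \int[mu]_x f x.
    move=> f2; transitivity (\int[mu]_x (f x * (1 * T x - a * cst 1 x))).
      by apply: eq_Rintegral => x _ /=; ring.
    rewrite (Rintegral_mul_comb 1 a f2 T2 (L2_cst mu 1)) mul1r.
    congr (_ - _ * _); apply: eq_Rintegral => x _; first exact: mulrC.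
    exact: mulr1.
  have lin' (f : X -> R) (a : R) : L2 mu f ->
      \int[mu]_x ((a - T x) * f x) =
      a * \int[mu]_x f x - \int[mu]_x (T x * f x).
    move=> f2; rewrite -opprB -lin// -mulN1r -RintegralZl//; last first.
      apply: L2_mul_integrable => //.
      have := L2_comb 1 (- a) T2 (L2_cst mu 1); congr (L2 _ _).
      by apply/funext => x /=; ring.
    by apply: eq_Rintegral => x _; ring.
  apply: (Hslope _ _ lam lam0).
  - have := Nm _ Fl; have := Nm _ Fu; rewrite /N /N' !lin// !lin'//.
    by rewrite /A N1 N'1 => i1 i2; apply/andP; split; lra.
  - have := NM _ Fl; have := NM _ Fu; rewrite /N /N' !lin// !lin'//.
    by rewrite /A' N1 N'1 => i1 i2; apply/andP; split; lra.
have Cmh : C (h \- mh \*o h').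
  by apply/coneG_subP' => // k Fk; have [] := slopes k Fk.
have CMh : C (Mh \*o h' \- h).
  by apply/coneG_subP => // k Fk; have [] := slopes k Fk.
have mhMh : 1 <= Mh / mh.
  rewrite ler_pdivlMr// mul1r.
  have S0 : 0 < S by exact: lt_le_trans sS.
  (* With [lam] equal to [S^-1] the upper bounds become equalities for the constant 1, which thus
     has a slope between [mh] and [Mh]. *)
  have [|||h1 h3] := Hslope (N (cst 1)) (N' (cst 1)) S^-1.
  - by rewrite invr_ge0 ltW.
  - rewrite divff ?gt_eqF// mul1r lexx andbT ler_piMl//.
    by rewrite ler_pdivrMr// mul1r.
  - rewrite divff ?gt_eqF// mul1r lexx andbT ler_piMl//.
    by rewrite ler_pdivrMr// mul1r.
  by have := le_trans h1 h3; rewrite N'1 ler_pM2r.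
rewrite /hilbert_metric; case: asboolP => [_|[]].
  by rewrite -EFinM lee_fin (le_trans (ln_hilb_ratio_le mh0 Mh0 Cmh CMh mhMh)).
split=> //; split; first by exists Mh.
exists mh^-1; first by rewrite invr_gt0.
apply/coneG_subP => // k Fk; rewrite ler_pdivlMl//.
by have [] := slopes k Fk.
Qed.

End HilbertContraction.

(** * Tails *)

Section Distance.
Context {R : realType} {d : measure_display} {X : measurableType d}.
Variable dX : X -> X -> R.
Hypothesis pX : polish_borel dX.

Lemma dist_ge0 x y : 0 <= dX x y.
Proof. by case: pX => -[]. Qed.

Lemma measurable_Bclosed x r : measurable (Bclosed dX x r).
Proof.
case: pX => -[_ _ dsym dtri] _ _ mE.
rewrite -[Bclosed _ _ _]setCK; apply: measurableC; rewrite mE.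
apply: sub_sigma_algebra => y /= /negP; rewrite -ltNge => xy.
exists (dX x y - r); first by rewrite subr_gt0.
move=> z /= yz; apply/negP; rewrite -ltNge.
by have := dtri x z y; rewrite (dsym z y); rewrite /dball/= in yz; lra.
Qed.

Lemma measurable_dist x : measurable_fun setT (dX x).
Proof.
apply: (measurability _ (RGenOInfty.measurableE R)) => //.
move=> _ [_ [r ->] <-]; rewrite setTI.
have -> : dX x @^-1` `]r, +oo[ = ~` Bclosed dX x r.
  apply/seteqP; split=> y /=; rewrite in_itv/= andbT ltNge => /negP//.
by apply: measurableC; exact: measurable_Bclosed.
Qed.

Lemma Bclosed_subset x (r s : R) : r <= s -> Bclosed dX x r `<=` Bclosed dX x s.
Proof. by move=> rs y /=; rewrite /Bclosed/= => /le_trans; apply. Qed.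

Lemma exists_dyadic_shell (x y : X) (m : R) : 0 < m -> m < dX x y ->
  exists j : nat, m * 2 ^+ j < dX x y <= m * 2 ^+ j.+1.
Proof.
move=> m0 my.
have : exists n : nat, dX x y <= m * 2 ^+ n.
  exists (Num.bound (dX x y / m)); rewrite -ler_pdivrMl// mulrC.
  have h0 : 0 <= dX x y / m by rewrite divr_ge0 ?dist_ge0// ltW.
  apply: (le_trans (ltW (archi_boundP h0))).
  by rewrite -natrX ler_nat ltnW// ltn_expl.
move=> /ex_minnP[[|j] hj jmin].
  by move: hj; rewrite expr0 mulr1 leNgt my.
exists j; rewrite hj andbT ltNge; apply/negP => /jmin.
by rewrite ltnn.
Qed.

Variables (x0 : X) (p a m tau : R).
Hypothesis p0 : 0 <= p.
Hypothesis m0 : 0 < m.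
(** The weight at the outer radius of a shell is played against the mass beyond its inner radius;
    the right sides form a geometric series with sum [tau]. *)
Hypothesis shell_tau : forall j : nat,
  expR (2 * (m * 2 ^+ j.+1) `^ p) * expR (- (m * 2 ^+ j) `^ a) <=
  tau / (2 ^ j.+1)%:R.

Let q x := expR ((Num.max (dX x0 x) m) `^ p).

Let radius_ge (j : nat) : m <= m * 2 ^+ j.
Proof. by rewrite ler_peMr ?(ltW m0)// exprn_ege1// ler1n. Qed.

Lemma measurable_weight : measurable_fun setT q.
Proof.
apply: measurableT_comp => //; apply: (measurableT_comp (measurable_powR _)).
by apply: measurable_maxr => //; exact: measurable_dist.
Qed.

(* Dyadic shells: q^2 <= exp (2 (2 s)^p) where s < d(x0, x) <= 2 s. *)
Lemma weight_tail (rho : probability X R) (h : X -> R) (lam : R) :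
  (forall x, 0 <= h x) -> rho.-integrable setT (EFin \o h) -> 0 <= lam ->
  (forall r, m <= r ->
    \int[rho]_(x in ~` Bclosed dX x0 r) h x <= lam * expR (- r `^ a)) ->
  rho.-integrable setT (EFin \o (fun x => h x * q x ^+ 2)) /\
  \int[rho]_(x in ~` Bclosed dX x0 m) (h x * q x ^+ 2) <= lam * tau.
Proof.
move=> h0 Ih lam0 hr; set B := Bclosed dX x0.
have mB r : measurable (B r) by exact: measurable_Bclosed.
have mCB r : measurable (~` B r) by exact: measurableC.
have mh := integrable_measurable Ih; have mq := measurable_weight.
have mhq : measurable_fun setT (fun x => h x * q x ^+ 2).
  by apply: measurable_funM => //; exact: measurable_funX.
have hq0 x : 0 <= h x * q x ^+ 2 by rewrite mulr_ge0// sqr_ge0.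
pose c j := expR (2 * (m * 2 ^+ j.+1) `^ p).
(* [f j] is supported on the whole complement of the inner ball, not just on the shell: the series
   still dominates, and the tail hypothesis applies to each term directly. *)
pose f j x := ((c j)%:E * ((EFin \o h) \_ (~` B (m * 2 ^+ j)%R)) x)%E.
have f0 j x : (0 <= f j x)%E.
  apply: mule_ge0; first by rewrite lee_fin expR_ge0.
  by rewrite patchE; case: ifP => // _; rewrite lee_fin.
have mf j : measurable_fun (~` B m) (f j).
  apply: measurable_funeM; apply: (measurable_funS measurableT) => //.
  apply/(measurable_restrictT _ _).1 => //.
  by apply/measurable_EFinP; exact: (measurable_funS measurableT).
have hqf x : (~` B m) x -> ((h x * q x ^+ 2)%:E <= \sum_(j <oo) f j x)%E.
  move=> /= /negP; rewrite -ltNge => mx.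
  have [j /andP[j1 j2]] := exists_dyadic_shell m0 mx.
  rewrite (@nneseriesD1 _ _ j)//; apply: (@le_trans _ _ (f j x)); last first.
    by rewrite leeDl// nneseries_ge0.
  rewrite /f patchE mem_set/=; last by apply/negP; rewrite -ltNge.
  rewrite -EFinM lee_fin mulrC ler_wpM2r//.
  rewrite /q max_l ?(ltW mx)// -expRM_natl /c ler_expR ler_pM2l//.
  apply: ge0_ler_powR => //; rewrite nnegrE ?dist_ge0//.
  by rewrite mulr_ge0 ?(ltW m0)// exprn_ge0.
have bnd : (\int[rho]_(x in ~` B m) (h x * q x ^+ 2)%:E <= (lam * tau)%:E)%E.
  apply: (@le_trans _ _ (\int[rho]_(x in ~` B m) (\sum_(j <oo) f j x))%E).
    apply: ge0_le_integral => //.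
    - by move=> x _; rewrite lee_fin.
    - by apply/measurable_EFinP; exact: (measurable_funS measurableT).
    - by apply: ge0_emeasurable_sum.
  rewrite integral_nneseries//.
  have lt0 : 0 <= lam * tau.
    rewrite mulr_ge0//; have := le_trans _ (shell_tau 0).
    move=> /(_ 0); rewrite mulr_ge0 ?expR_ge0// => /(_ isT).
    by rewrite pmulr_lge0// invr_gt0.
  apply: le_trans (epsilon_trick0 xpredT lt0).
  apply: lee_nneseries => [j _ _|j _]; first exact: integral_ge0.
  rewrite ge0_integralZl//; last 3 first.
  - apply: (measurable_funS measurableT) => //.
    apply/(measurable_restrictT _ _).1 => //.
    by apply/measurable_EFinP; exact: (measurable_funS measurableT).
  - by move=> x _; rewrite patchE; case: ifP => // _; rewrite lee_fin.
  - by rewrite lee_fin expR_ge0.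
  rewrite -integral_mkcondr setIidr; last first.
    by apply: subsetC; apply: Bclosed_subset.
  have := hr _ (radius_ge j); rewrite /Rintegral -lee_fin fineK; last first.
    by apply: integrable_fin_num => //; exact: integrable_restr Ih.
  move=> hj; apply: (le_trans (lee_wpmul2l _ hj)).
    by rewrite lee_fin expR_ge0.
  rewrite -EFinM lee_fin mulrCA -mulrA ler_wpM2l//.
  exact: shell_tau.
have Itail : rho.-integrable (~` B m) (EFin \o (fun x => h x * q x ^+ 2)).
  apply/integrableP; split.
    by apply/measurable_EFinP; exact: (measurable_funS measurableT).
  under eq_integral do rewrite gee0_abs ?lee_fin//.
  exact: le_lt_trans bnd (ltry _).
split; last first.
  by rewrite -lee_fin /Rintegral fineK//; exact: integrable_fin_num Itail.
apply: (integrable_le_norm (g := fun x => h x * expR (m `^ p) ^+ 2 +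
    ((fun x => h x * q x ^+ 2) \_ (~` B m)) x)) => //.
- move=> x _; rewrite ger0_norm// patchE; case: ifPn => [_|].
    by rewrite lerDr mulr_ge0// sqr_ge0.
  rewrite notin_setE /= => /contrapT xm; rewrite addr0 ler_wpM2l//.
  by rewrite /q max_r.
- apply: integrable_addr; first exact: measurableT.
    have := integrable_scaler (expR (m `^ p) ^+ 2) measurableT Ih.
    by apply: eq_integrable => // x _ /=; rewrite mulrC.
  have := (integrable_mkcond _ (mCB m)).1 Itail.
  by apply: eq_integrable => // x _ /=; rewrite restrict_EFin.
Qed.

End Distance.

(** * The cones of test functions and of potentials *)

Section ConeFacts.
Context {R : realType} {d : measure_display} {X : measurableType d}.
Variables (dX : X -> X -> R) (x0 : X) (mu : probability X R).
Hypothesis pX : polish_borel dX.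
Variables (m Lam : R) (alpha : R -> R).
Hypothesis Lam1 : 1 <= Lam.
Hypothesis alpha0 : forall r, 0 < alpha r.
Hypothesis alpham : alpha m <= 4^-1.
Hypothesis mu_tail : forall r, m <= r ->
  4 * Lam * fine (mu (~` Bclosed dX x0 r)) <= alpha r.

Let F := coneF dX x0 m m alpha alpha mu.
Let B := Bclosed dX x0.
Implicit Types f g k : X -> R.

Let mB r : measurable (B r). Proof. exact: measurable_Bclosed. Qed.
Let mCB r : measurable (~` B r). Proof. exact: measurableC. Qed.

Let tail_ge0 r : 0 <= fine (mu (~` B r)).
Proof. by rewrite fine_ge0. Qed.

Lemma fine_probability_setC (A : set X) : measurable A ->
  fine (mu A) = 1 - fine (mu (~` A)).
Proof.
move=> mA; have fA : mu A \is a fin_num by exact: fin_num_measure.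
rewrite probability_setC// -(fineK fA) -EFinB /=; ring.
Qed.

(** The integral of [f] is at least [beta / 4] since little mass lies off the ball, and either tail
    is at most b mu (B_r^c) <= Lam beta mu (B_r^c) <= alpha r * beta / 4. The factor 4 in [mu_tail]
    serves this comparison. *)
Lemma coneF_of_bounds f (beta b : R) : measurable_fun setT f ->
  (forall x, `|f x| <= b) -> (forall x, B m x -> beta <= f x) ->
  0 <= beta -> b <= Lam * beta -> F f.
Proof.
move=> mf fb fB beta0 bL.
have f2 : L2 mu f by apply: (L2_le_norm (g := cst b)) => //; exact: L2_cst.
have If := L2_integrable f2.
have b0 : 0 <= b by exact: le_trans (normr_ge0 _) (fb x0).
have parts r f' : measurable_fun setT f' -> (forall x, 0 <= f' x <= b) ->
    \int[mu]_(x in ~` B r) f' x <= b * fine (mu (~` B r)).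
  move=> mf' f'b; rewrite -Rintegral_cst//; apply: le_Rintegral => //.
  - apply: (integrable_le_norm (g := cst b)) => //.
    + exact: (measurable_funS measurableT).
    + by move=> x _; have /andP[h0 h1] := f'b x; rewrite ger0_norm.
    + exact: integrable_cstP.
  - exact: integrable_cstP.
  - by move=> x _; have /andP[] := f'b x.
have int_ge : beta / 4 <= \int[mu]_x f x.
  rewrite (Rintegral_split (mB m) If).
  have h1 : beta * fine (mu (B m)) <= \int[mu]_(x in B m) f x.
    rewrite -Rintegral_cst//; apply: le_Rintegral => //.
    - exact: integrable_cstP.
    - exact: integrable_restr If.
  have h2 : - b * fine (mu (~` B m)) <= \int[mu]_(x in ~` B m) f x.
    rewrite -Rintegral_cst//; apply: le_Rintegral => //.
    - exact: integrable_cstP.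
    - exact: integrable_restr If.
    - by move=> x _; have := fb x; rewrite ler_norml => /andP[].
  rewrite fine_probability_setC// in h1.
  have t0 := tail_ge0 m; set t := fine (mu (~` B m)) in h1 h2 t0 *.
  have t4 : 4 * Lam * t <= 4^-1 by apply: le_trans alpham; exact: mu_tail.
  have : b * t <= Lam * beta * t by exact: ler_wpM2r.
  have : beta * (4 * Lam * t) <= beta * 4^-1 by exact: ler_wpM2l.
  have : 1 * (beta * t) <= Lam * (beta * t).
    by apply: ler_wpM2r => //; rewrite mulr_ge0.
  lra.
have tail r f' : m <= r -> measurable_fun setT f' ->
    (forall x, 0 <= f' x <= b) ->
    \int[mu]_(x in ~` B r) f' x <= alpha r * \int[mu]_x f x.
  move=> mr mf' /(parts r _ mf') /le_trans; apply.
  apply: (@le_trans _ _ (alpha r * (beta / 4))); last first.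
    by rewrite ler_wpM2l// ltW.
  have : b * fine (mu (~` B r)) <= Lam * beta * fine (mu (~` B r)).
    exact: ler_wpM2r.
  have : beta * (4 * Lam * fine (mu (~` B r))) <= beta * alpha r.
    by apply: ler_wpM2l => //; exact: mu_tail.
  lra.
split=> //.
- by apply: nearW => x Bx; exact: le_trans beta0 (fB x Bx).
- move=> r mr; apply: tail => //; first exact: measurable_maxr.
  move=> x; rewrite /pos_part le_max lexx orbT ge_max b0 andbT/=.
  exact: le_trans (ler_norm _) (fb x).
- move=> r mr; apply: tail => //.
    by apply: measurable_maxr => //; exact: measurableT_comp.
  move=> x; rewrite /neg_part le_max lexx orbT ge_max b0 andbT/=.
  by rewrite (le_trans _ (fb x))// -normrN ler_norm.
Qed.

Lemma coneF_cst1 : F (cst 1).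
Proof.
apply: (coneF_of_bounds (beta := 1) (b := 1)) => //; last by rewrite mulr1.
by move=> x; rewrite normr1.
Qed.

(** The factors 2 leave room: [f - beta] is still at least [beta] on the ball and [2 * b - f] at
    least [b] everywhere, so [coneF_of_bounds] applies with the ratios 2 b / beta and 3. *)
Lemma coneF_sandwich f (beta b : R) : measurable_fun setT f ->
  (forall x, `|f x| <= b) -> (forall x, B m x -> 2 * beta <= f x) ->
  0 <= beta -> beta <= b -> 2 * b <= Lam * beta -> 3 <= Lam ->
  F (fun x => f x - beta) /\ F (fun x => 2 * b - f x).
Proof.
move=> mf fb fB beta0 betab bL L3; have b0 : 0 <= b by exact: le_trans betab.
split.
- apply: (coneF_of_bounds (beta := beta) (b := 2 * b)) => //.
  + exact: measurable_funB.
  + move=> x; have := fb x; rewrite !ler_norml => /andP[h1 h2].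
    by apply/andP; split; lra.
  + by move=> x /fB; lra.
- apply: (coneF_of_bounds (beta := b) (b := 3 * b)) => //.
  + exact: measurable_funB.
  + move=> x; have := fb x; rewrite !ler_norml => /andP[h1 h2].
    by apply/andP; split; lra.
  + by move=> x _; have := fb x; rewrite ler_norml => /andP[h1 h2]; lra.
  + exact: ler_wpM2r.
Qed.

Lemma coneF_abs_tail k r : F k -> m <= r ->
  \int[mu]_(x in ~` B r) `|k x| <= 2 * alpha r * \int[mu]_x k x.
Proof.
move=> [k2 _ kp kn] mr; have Ik := integrable_restr (mCB r) (L2_integrable k2).
have mk := integrable_measurable Ik.
have Ip : mu.-integrable (~` B r) (EFin \o pos_part k).
  apply: (integrable_le_norm (g := Num.norm \o k)) => //.
  - exact: measurable_maxr.
  - move=> x _; rewrite /pos_part /Num.max; case: ifP => _ /=; last by [].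
    by rewrite normr0.
  - exact: integrable_norm.
have In : mu.-integrable (~` B r) (EFin \o neg_part k).
  apply: (integrable_le_norm (g := Num.norm \o k)) => //.
  - by apply: measurable_maxr => //; exact: measurableT_comp.
  - move=> x _; rewrite /neg_part /Num.max; case: ifP => _ /=.
      by rewrite normr0.
    by rewrite normrN.
  - exact: integrable_norm.
have -> : \int[mu]_(x in ~` B r) `|k x| =
    \int[mu]_(x in ~` B r) pos_part k x + \int[mu]_(x in ~` B r) neg_part k x.
  rewrite -RintegralD//; apply: eq_Rintegral => x _; rewrite /pos_part /neg_part.
  have /orP[k0|k0] := le_total 0 (k x).
    by rewrite ger0_norm// max_l// max_r ?addr0// oppr_le0.
  by rewrite ler0_norm// max_r// max_l ?add0r// oppr_ge0.
by have := lerD (kp r mr) (kn r mr); rewrite mulrDl mul1r mulrDl.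
Qed.

(** The tail condition forces the sign: a nonnegative tail is at most [2 * alpha m] times the
    integral, and [alpha m] is positive. *)
Lemma coneF_integral_ge0 k : F k -> 0 <= \int[mu]_x k x.
Proof.
move=> Fk; have h := coneF_abs_tail Fk (lexx m).
rewrite -(pmulr_rge0 _ (mulr_gt0 (ltr0Sn R 1) (alpha0 m))).
by apply: le_trans h; apply: Rintegral_ge0.
Qed.

Lemma coneF_ball k : F k -> \int[mu]_x k x / 2 <=
  \int[mu]_(x in B m) k x <= 2 * \int[mu]_x k x.
Proof.
move=> Fk; have l0 := coneF_integral_ge0 Fk.
have h := coneF_abs_tail Fk (lexx m).
have [k2 _ _ _] := Fk; have Ik := L2_integrable k2.
have E := Rintegral_split (mB m) Ik.
have : `|\int[mu]_(x in ~` B m) k x| <= \int[mu]_(x in ~` B m) `|k x|.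
  by apply: le_normr_Rintegral => //; exact: integrable_restr Ik.
rewrite ler_norml => /andP[n1 n2].
have : alpha m * \int[mu]_x k x <= 4^-1 * \int[mu]_x k x by exact: ler_wpM2r.
by move=> a4; apply/andP; split; lra.
Qed.

Variable g : X -> R.
Hypothesis Gg : coneG dX x0 m m alpha alpha mu g.
Hypothesis gnz : ~ ae_zero mu g.
Hypothesis g0 : {ae mu, forall x, 0 <= g x}.

Lemma coneG_integrable : mu.-integrable setT (EFin \o g).
Proof. by apply: L2_integrable; case: Gg. Qed.

Lemma coneG_integral_gt0 : 0 < \int[mu]_x g x.
Proof.
have Ig := coneG_integrable.
rewrite lt_neqAle; apply/andP; split; last first.
  have -> : 0 = \int[mu]_x (cst 0 x : R) by rewrite Rintegral_cst// mul0r.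
  apply: ae_le_Rintegral => //; first exact: integrable_cstP.
  by apply: filterS g0 => x gx _.
apply/eqP => E; apply: gnz.
have : ae_eq mu setT (EFin \o g) (cst 0%E).
  apply/ae_eq_integral_abs => //; first exact: measurable_int Ig.
  have I0 : (\int[mu]_x (g x)%:E)%E = 0%E.
    by rewrite -(fineK (integrable_fin_num measurableT Ig)) -[fine _]E.
  rewrite -I0; apply: ae_eq_integral => //.
  - by apply: measurableT_comp => //; exact: measurable_int Ig.
  - exact: measurable_int Ig.
  - by apply: filterS g0 => x gx _ /=; rewrite ger0_norm.
by apply: filterS => x /(_ Logic.I) /= [].
Qed.

(** Test [g] against the function that is 1 on the ball and -1 off it. It belongs to F, whose
    members may be negative off the ball, and the pairing says that [g] has at least as much
    integral on the ball as outside. *)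
Lemma coneG_ball : \int[mu]_x g x <= 2 * \int[mu]_(x in B m) g x.
Proof.
have Ig := coneG_integrable; have [g2 gF] := Gg.
pose f x : R := 2 * \1_(B m) x - 1.
have fT x : B m x -> f x = 1 by move=> Bx; rewrite /f indicE mem_set//= mulr1; lra.
have fN x : (~` B m) x -> f x = -1.
  by move=> Bx; rewrite /f indicE memNset// mulr0 sub0r.
have mf : measurable_fun setT f.
  by apply: measurable_funB => //; apply: measurable_funM.
have f1 x : `|f x| <= 1.
  by have [/fT ->|/fN ->] := pselect (B m x); rewrite ?normrN normr1.
have Ff : F f.
  apply: (coneF_of_bounds (beta := 1) (b := 1)) => //; last by rewrite mulr1.
  by move=> x /fT ->.
have Ifg : mu.-integrable setT (EFin \o (fun x => f x * g x)).
  by apply: L2_mul_integrable => //; case: Ff.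
have := gF f Ff; rewrite (Rintegral_split (mB m) Ifg) (Rintegral_split (mB m) Ig).
have -> : \int[mu]_(x in B m) (f x * g x) = \int[mu]_(x in B m) g x.
  by apply: eq_Rintegral => x /set_mem /fT ->; rewrite mul1r.
have -> : \int[mu]_(x in ~` B m) (f x * g x) = - \int[mu]_(x in ~` B m) g x.
  rewrite -mulN1r -RintegralZl//; last exact: integrable_restr Ig.
  by apply: eq_Rintegral => x /set_mem /fN ->.
lra.
Qed.

End ConeFacts.

(** * Choice of the radius *)

Section Growth.
Context {R : realType}.
Implicit Types x y r p t : R.

Lemma powR_ge_of_root t c m : 0 < t -> 0 <= c -> c `^ t^-1 <= m -> c <= m `^ t.
Proof.
move=> t0 c0 cm; rewrite -[c]powRr1// -(mulVf (lt0r_neq0 t0)) powRrM.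
by apply: ge0_ler_powR; rewrite ?nnegrE ?powR_ge0 ?(ltW t0)// (le_trans _ cm)// powR_ge0.
Qed.

Lemma ler_powR_base t x y : 0 <= t -> 0 <= x -> x <= y -> x `^ t <= y `^ t.
Proof.
by move=> t0 x0 xy; apply: ge0_ler_powR => //; rewrite nnegrE// (le_trans x0).
Qed.

Lemma expRN_le_half_pow (n : nat) : expR (- n%:R : R) <= 2^-1 ^+ n.
Proof.
rewrite expRN -[n%:R]mulr1 expRM_natl -exprVn.
apply: lerXn2r; rewrite ?nnegrE ?invr_ge0 ?expR_ge0//.
rewrite lef_pV2 ?posrE ?expR_gt0//.
by have := expR_ge1Dx (1 : R); rewrite -natr1.
Qed.

Variables p delta m : R.
Hypothesis p0 : 0 < p.
Hypothesis delta0 : 0 < delta.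
Hypothesis m1 : 1 <= m.
(** The term 2 * 2^p pays for q^2 at the outer radius 2 s of a shell. The 16 = 14 + 1 + 1 pays for
    the 14 m^p in [tau], for its factor 2^14, and for the dyadic factor 2^(j+1). *)
Hypothesis m_delta : 2 * 2 `^ p + 16 <= m `^ (delta / 2).
Hypothesis m_p : 14 <= m `^ p.
Hypothesis m_2p : 1 <= m `^ p * (2 `^ p - 1).

Let m0 : 0 < m. Proof. exact: lt_le_trans ltr01 m1. Qed.

Let powR_addhalf s t : m <= s -> s `^ t * (2 * 2 `^ p + 16) <= s `^ (t + delta / 2).
Proof.
move=> ms; have s0 : 0 < s by exact: lt_le_trans m0 ms.
rewrite powRD; last by apply/implyP => _; rewrite gt_eqF.
rewrite ler_wpM2l ?powR_ge0// (le_trans m_delta)//.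
by apply: ler_powR_base => //; rewrite ltW// divr_gt0.
Qed.

Let pow2p : 1 <= 2 `^ p.
Proof.
have := @ler_powR_base p 1 2 (ltW p0) ler01; rewrite powR1; apply.
by rewrite ler1n.
Qed.

Let powR_ge_m s : m <= s -> m `^ p <= s `^ p.
Proof. by move=> ms; apply: ler_powR_base => //; rewrite ltW. Qed.

Lemma shell_growth (j : nat) :
  expR (2 * (m * 2 ^+ j.+1) `^ p) * expR (- (m * 2 ^+ j) `^ (p + delta / 2)) <=
  (expR (m `^ p))^-1 ^+ 14 / 2 ^+ 14 / (2 ^ j.+1)%:R.
Proof.
set s := m * 2 ^+ j.
have ms : m <= s by rewrite ler_peMr ?(ltW m0)// exprn_ege1// ler1n.
have s0 : 0 < s by exact: lt_le_trans ms.
have -> : m * 2 ^+ j.+1 = 2 * s by rewrite /s exprS; ring.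
rewrite powRM ?(ltW s0)//.
have ya := powR_addhalf p ms; have ym := powR_ge_m ms.
have yj : j.+1%:R <= s `^ p.
  rewrite /s powRM ?exprn_ge0 ?(ltW m0)//.
  rewrite -powR_mulrn// -powRrM [_%:R * p]mulrC powRrM powR_mulrn ?powR_ge0//.
  (* Bernoulli's inequality; by [m_2p] each of the [j] increments is at least 1 after multiplication
     by m^p. *)
  have B : 1 + j%:R * (2 `^ p - 1) <= (2 `^ p) ^+ j.
    elim: j {s ms s0 ya ym} => [|j IH]; first by rewrite mul0r addr0 expr0.
    rewrite exprS -natr1.
    have : 2 `^ p * (1 + j%:R * (2 `^ p - 1)) <= 2 `^ p * (2 `^ p) ^+ j.
      by rewrite ler_wpM2l ?powR_ge0.
    have : 0 <= j%:R * (2 `^ p - 1) * (2 `^ p - 1).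
      by rewrite !mulr_ge0 ?subr_ge0.
    lra.
  have : m `^ p * (1 + j%:R * (2 `^ p - 1)) <= m `^ p * (2 `^ p) ^+ j.
    by rewrite ler_wpM2l ?powR_ge0.
  have : j%:R * 1 <= j%:R * (m `^ p * (2 `^ p - 1)) by rewrite ler_wpM2l.
  rewrite -natr1; move: m_p; lra.
have -> : (expR (m `^ p))^-1 ^+ 14 / 2 ^+ 14 / (2 ^ j.+1)%:R =
    expR (- (14 * m `^ p)) * (2^-1 ^+ 14 * 2^-1 ^+ j.+1).
  rewrite expRN expRM_natl exprVn mulrA.
  by rewrite natrX -!exprVn.
have h14 := expRN_le_half_pow 14; have hj := expRN_le_half_pow j.+1.
apply: (@le_trans _ _ (expR (- (14 * m `^ p)) * (expR (- 14%:R) * expR (- j.+1%:R)))).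
  rewrite -!expRD ler_expR; move: ya ym yj m_p.
  set y := s `^ p; set z := s `^ _; set c := 2 `^ p; set w := m `^ p.
  by move=> *; lra.
by rewrite ler_wpM2l ?expR_ge0// ler_pM// expR_ge0.
Qed.

Lemma alpha_small r : m <= r -> expR (- r `^ (p + delta / 2)) <= 4^-1.
Proof.
move=> mr; have h := powR_addhalf p mr; have h' := powR_ge_m mr.
apply: (@le_trans _ _ (expR (- 2%:R))).
  rewrite ler_expR lerN2 (le_trans _ h)//.
  have : 2 <= r `^ p by move: m_p; lra.
  by move: pow2p; nra.
apply: le_trans (expRN_le_half_pow 2) _; lra.
Qed.

(** Raising the exponent by delta/2 gains a factor of at least 18, once from p to p + delta/2 and
    once more to p + delta. This outweighs 16 m^p + 19, where 19 accounts for 4 * 2^17 = 2^19 <=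
    e^19. *)
Lemma light_tail r : m <= r ->
  4 * (2 ^+ 17 * expR (m `^ p) ^+ 16) * expR (- r `^ (p + delta)) <=
  expR (- r `^ (p + delta / 2)).
Proof.
move=> mr; have h := powR_addhalf p mr; have h' := powR_ge_m mr.
have := powR_addhalf (p + delta / 2) mr.
have -> : p + delta / 2 + delta / 2 = p + delta by field.
move: h h' m_p pow2p; set b := r `^ (p + delta); set a := r `^ (p + _).
set y := r `^ p; set w := m `^ p; set c := 2 `^ p => ya wy w14 c1 ab.
have -> : 4 * (2 ^+ 17 * expR w ^+ 16) * expR (- b) =
  2 ^+ 19 * (expR w ^+ 16 * expR (- b)) by ring.
have h19 := expRN_le_half_pow 19.
apply: (@le_trans _ _ (2 ^+ 19 * (2^-1 ^+ 19 * expR (- a)))); last first.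
  by rewrite mulrA -exprMn divff// expr1n mul1r.
rewrite ler_wpM2l//.
apply: le_trans (ler_wpM2r (expR_ge0 _) h19).
rewrite -expRM_natl -!expRD ler_expR.
have ya' : y * 18 <= a by apply: le_trans ya; apply: ler_wpM2l; lra.
have ab' : a * 18 <= b by apply: le_trans ab; apply: ler_wpM2l; lra.
lra.
Qed.

End Growth.

Lemma cost_growth (R : realType) (d : measure_display) (X : measurableType d)
    (dX : X -> X -> R) (x0 : X) (c : X -> X -> R) (eps p : R) : 0 < eps ->
  (fun r : R => (ereal_sup [set (c xy.1 xy.2)%:E | xy in
       Bclosed dX x0 r `*` Bclosed dX x0 r] * ((r `^ p)^-1)%:E)%E)
     @ +oo --> (0 : \bar R) ->
  exists M : R, forall r x y, M < r -> Bclosed dX x0 r x -> Bclosed dX x0 r y ->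
    c x y <= eps * r `^ p.
Proof.
move=> eps0 Hc.
have e0 : ((0 : \bar R) < eps%:E)%E by rewrite lte_fin.
have [M [_ HM]] := Hc _ (open_ereal_lt' e0).
exists (Num.max M 0) => r x y; rewrite gt_max => /andP[Mr r0] Bx By.
have rp0 : 0 < r `^ p by exact: powR_gt0.
have h := HM r Mr; rewrite /= in h.
have : ((c x y)%:E * ((r `^ p)^-1)%:E < eps%:E)%E.
  apply: le_lt_trans h; apply: lee_wpmul2r.
    by rewrite lee_fin invr_ge0 ltW.
  by apply: ereal_sup_ubound; exists (x, y).
by rewrite -EFinM lte_fin ltr_pdivrMr// => /ltW.
Qed.

Lemma tail_growth (R : realType) (f b : R -> R) :
  (forall r, 0 < b r) -> (fun r => f r / b r) @ +oo --> (0 : R) ->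
  exists M : R, forall r, M < r -> f r <= b r.
Proof.
move=> b0 Hf; have [M [_ HM]] : \forall r \near +oo, f r / b r < 1.
  exact: (cvgr_lt _ Hf).
exists M => r /HM; by rewrite ltr_pdivrMr// mul1r => /ltW.
Qed.

(** [s] is half of the lower bound of the operator on the ball and [S] twice its upper bound, as
    [coneF_sandwich] demands. Their quotient S / s = 2^17 Q^16 is the admissible ratio [Lam] of the
    theorem. *)
Lemma contraction_constants (R : realType) (Q lam : R) : 1 <= Q -> 0 <= lam ->
  let s := Q^-1 ^+ 8 / 512 in let S := 256 * Q ^+ 8 in
  [/\ 0 <= s * lam, s * lam <= 128 * Q ^+ 8 * lam,
    S * lam = 2 * (128 * Q ^+ 8 * lam),
    2 * (s * lam) = Q^-1 ^+ 8 / 256 * lam &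
    2 * (128 * Q ^+ 8 * lam) <= 2 ^+ 17 * Q ^+ 16 * (s * lam)].
Proof.
move=> Q1 lam0 s S; have Q0 : 0 < Q by exact: lt_le_trans Q1.
have P8 : 0 <= Q^-1 ^+ 8 by rewrite exprn_ge0// invr_ge0 ltW.
have P81 : Q^-1 ^+ 8 * lam <= 1 * lam.
  by rewrite ler_wpM2r// exprn_ile1 ?invf_le1// invr_ge0 ltW.
have Q8 : 1 * lam <= Q ^+ 8 * lam by rewrite ler_wpM2r// exprn_ege1.
have sE : s * lam = Q^-1 ^+ 8 * lam / 512 by rewrite /s mulrAC.
split.
- by rewrite sE; have := mulr_ge0 P8 lam0; lra.
- by rewrite sE; lra.
- by rewrite /S; ring.
- by rewrite sE; lra.
- have -> : 2 ^+ 17 * Q ^+ 16 * (s * lam) = 256 * (Q * Q^-1) ^+ 8 * Q ^+ 8 * lam.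
    by rewrite /s; field; rewrite gt_eqF.
  by rewrite divff ?gt_eqF// expr1n; lra.
Qed.

Theorem theorem5p5 (R : realType) (d : measure_display) (X : measurableType d)
  (dX : X -> X -> R) (x0 : X)
  (mu nu : probability X R) (eps : R) (c : X -> X -> R) :
  polish_borel dX ->
  0 < eps ->
  (forall x y, 0 <= c x y) ->
  measurable_fun [set: X * X] (fun z : X * X => c z.1 z.2) ->
  (mu \x nu)%E.-integrable [set: X * X] (fun z : X * X => (c z.1 z.2)%:E) ->
  forall p delta : R, 0 < p -> 0 < delta ->
  (fun r : R => (ereal_sup [set (c xy.1 xy.2)%:E | xy in
       Bclosed dX x0 r `*` Bclosed dX x0 r] * ((r `^ p)^-1)%:E)%E)
     @ +oo --> (0 : \bar R) ->
  (fun r : R => Num.max (fine (mu (~` Bclosed dX x0 r)))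
                        (fine (nu (~` Bclosed dX x0 r)))
                / expR (- r `^ (p + delta))) @ +oo --> (0 : R) ->
  let K := fun x y => expR (- c x y / eps) in
  let alpha := fun r : R => expR (- r `^ (p + delta / 2)) in
  exists2 m_ : R, 0 < m_ &
    forall m : R, m_ <= m ->
      let G := coneG dX x0 m m alpha alpha mu in
      exists2 kappa : R, 0 < kappa < 1 &
        forall g g' : X -> R,
          G g -> ~ ae_zero mu g -> {ae mu, forall x, 0 <= g x} ->
          G g' -> ~ ae_zero mu g' -> {ae mu, forall x, 0 <= g' x} ->
          (hilbert_metric mu G (sinkhorn_map K mu nu g) (sinkhorn_map K mu nu g')
            <= kappa%:E * hilbert_metric mu G g g')%E.
Proof.
move=> pX eps0 c0 mc _ p delta p0 delta0 Hc Ht K alpha.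
have [M1 HM1] := cost_growth eps0 Hc.
have [M2 HM2] := tail_growth (fun r => expR_gt0 _) Ht.
have pow2p : 1 < 2 `^ p :> R.
  have : 1 `^ p < 2 `^ p :> R.
    by apply: gt0_ltr_powR; rewrite ?nnegrE// ltr1n.
  by rewrite powR1.
pose cD : R := 2 * 2 `^ p + 16; pose cp : R := 14 + (2 `^ p - 1)^-1.
have cD0 : 0 <= cD by rewrite addr_ge0// mulr_ge0// powR_ge0.
have cp0 : 0 <= cp by rewrite addr_ge0// invr_ge0 subr_ge0 ltW.
(* The roots turn lower bounds on powers of [m] into bounds on [m], with [cp] serving both [m_p] and
   [m_2p]. The summand 1 yields [1 <= m] and the strict inequalities [M1 < m] and [M2 < m]. *)
pose m_ := 1 + cD `^ (delta / 2)^-1 + cp `^ p^-1 + `|M1| + `|M2|.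
have rD := powR_ge0 cD (delta / 2)^-1; have rp := powR_ge0 cp p^-1.
have aM1 := normr_ge0 M1; have aM2 := normr_ge0 M2.
have lM1 := ler_norm M1; have lM2 := ler_norm M2.
exists m_; first by rewrite /m_; lra.
move=> m mm G; rewrite /m_ in mm.
have m1 : 1 <= m by lra.
have m0 : 0 < m by lra.
have m_delta : cD <= m `^ (delta / 2).
  by apply: powR_ge_of_root => //; [rewrite divr_gt0|lra].
have m_cp : cp <= m `^ p by apply: powR_ge_of_root => //; lra.
have inv0 : 0 < (2 `^ p - 1)^-1 :> R by rewrite invr_gt0 subr_gt0.
have m_p : 14 <= m `^ p by apply: le_trans m_cp; rewrite /cp; lra.
have m_2p : 1 <= m `^ p * (2 `^ p - 1).
  rewrite -ler_pdivrMr ?subr_gt0// mul1r; apply: le_trans m_cp.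
  by rewrite /cp lerDr.
pose Q := expR (m `^ p); pose tau := Q^-1 ^+ 14 / 2 ^+ 14.
pose Lam := 2 ^+ 17 * Q ^+ 16.
pose q x := expR ((Num.max (dX x0 x) m) `^ p).
have Q1 : 1 <= Q by rewrite -expR0 ler_expR powR_ge0.
have Q0 : 0 < Q by exact: lt_le_trans Q1.
have shell (j : nat) := shell_growth p0 delta0 m1 m_delta m_p m_2p j.
have mM2 r : m <= r -> M2 < r by lra.
have tailmu r : m <= r ->
    fine (mu (~` Bclosed dX x0 r)) <= expR (- r `^ (p + delta)).
  by move=> /mM2/HM2; rewrite ge_max => /andP[].
have tailnu r : m <= r ->
    fine (nu (~` Bclosed dX x0 r)) <= expR (- r `^ (p + delta)).
  by move=> /mM2/HM2; rewrite ge_max => /andP[].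
have mB r : measurable (Bclosed dX x0 r) by exact: measurable_Bclosed.
have mCB r : measurable (~` Bclosed dX x0 r) by exact: measurableC.
have light r (mr : m <= r) := light_tail p0 delta0 m1 m_delta m_p mr.
have Lam1 : 1 <= Lam.
  by rewrite /Lam; have := exprn_ege1 16 Q1; clear; lra.
have Lam3 : 3 <= Lam.
  by rewrite /Lam; have := exprn_ege1 16 Q1; clear; lra.
have alpha0 r : 0 < alpha r by exact: expR_gt0.
have alpham : alpha m <= 4^-1 by exact: (alpha_small p0 delta0 m1 m_delta m_p).
have mu_tail r : m <= r ->
    4 * Lam * fine (mu (~` Bclosed dX x0 r)) <= alpha r.
  move=> mr; apply: le_trans (light r mr).
  by apply: ler_wpM2l; [lra|exact: tailmu].
have p0' : 0 <= p by exact: ltW.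
have one_tail (rho : probability X R) :
    (forall r, m <= r ->
      fine (rho (~` Bclosed dX x0 r)) <= expR (- r `^ (p + delta))) ->
    rho.-integrable setT (EFin \o (fun x => q x ^+ 2)) /\
    \int[rho]_(x in ~` Bclosed dX x0 m) (q x ^+ 2) <= tau.
  move=> tailrho.
  (* The tails of the measures are lighter than [alpha], so the shell estimate with exponent p +
     delta/2 serves them as well as the test functions. *)
  have [||||I1 I2] := @weight_tail _ _ _ _ pX x0 p _ m tau p0' m0 shell rho (cst 1) 1.
  - by move=> x.
  - exact: integrable_cstP.
  - by [].
  - move=> r mr; rewrite Rintegral_cst// !mul1r.
    apply: le_trans (tailrho r mr) _; apply: le_trans _ (light r mr).
    by rewrite ler_peMl ?expR_ge0// -/Q -/Lam; lra.
  split; first by apply: eq_integrable I1 => // x _ /=; rewrite mul1r.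
  rewrite mul1r in I2; apply: le_trans I2.
  by under [leRHS]eq_Rintegral do rewrite mul1r.
have [muq _] := one_tail mu tailmu.
have [nuq nutau] := one_tail nu tailnu.
have mq : measurable_fun setT q by exact: measurable_weight.
have qB x : Bclosed dX x0 m x -> q x = Q.
  by move=> /= xm; rewrite /q max_r.
have qQ x : Q <= q x.
  rewrite ler_expR; apply: ler_powR_base => //; first exact: ltW.
  by rewrite le_max lexx orbT.
have mK : measurable_fun [set: X * X] (fun z : X * X => K z.1 z.2).
  apply: measurableT_comp => //; apply: measurable_funM => //.
  exact: measurableT_comp.
have K0 x y : 0 <= K x y by exact: expR_ge0.
have K1 x y : K x y <= 1.
  by rewrite -expR0 ler_expR mulNr oppr_le0 divr_ge0// ltW.
have Kq x y : (q x * q y)^-1 <= K x y.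
  rewrite -expRD -expRN ler_expR mulNr lerN2 ler_pdivrMr// mulrC.
  set rx := Num.max (dX x0 x) m; set ry := Num.max (dX x0 y) m.
  (* The cost is controlled on one ball containing both points. Its radius is [rx] or [ry], so r^p
     is at most the sum of the two powers, and the exponential splits into [q x * q y]. *)
  pose r := Num.max rx ry.
  have xr : rx <= r by rewrite le_max lexx.
  have yr : ry <= r by rewrite le_max lexx orbT.
  have xrx : dX x0 x <= rx by rewrite le_max lexx.
  have yry : dX x0 y <= ry by rewrite le_max lexx.
  have mrx : m <= rx by rewrite le_max lexx orbT.
  apply: (@le_trans _ _ (eps * r `^ p)).
    apply: HM1; first by lra.
    - exact: le_trans xrx xr.
    - exact: le_trans yry yr.
  rewrite ler_pM2l// /r /Num.max; case: ifP => _.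
    by rewrite lerDr powR_ge0.
  by rewrite lerDl powR_ge0.
pose s := Q^-1 ^+ 8 / 512; pose S := 256 * Q ^+ 8.
have [s0 sS] : 0 < s /\ s <= S.
  have [h0 h1 h2 _ _] := contraction_constants Q1 ler01.
  split; last by move: h0 h1 h2; rewrite -/s -/S !mulr1; clear; lra.
  by rewrite /s pmulr_lgt0 ?invr_gt0 ?ltr0n// exprn_gt0// invr_gt0.
have S0 : 0 < S by exact: lt_le_trans sS.
exists (S / (S + s)).
  rewrite divr_gt0 ?addr_gt0//= ltr_pdivrMr ?addr_gt0// mul1r.
  by rewrite ltrDl.
move=> g g' Gg gnz g0 Gg' g'nz g'0.
have Ig := coneG_integrable Gg; have Ig' := coneG_integrable Gg'.
have gI := coneG_integral_gt0 Gg gnz g0.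
have g'I := coneG_integral_gt0 Gg' g'nz g'0.
have gB := coneG_ball pX Lam1 alpha0 alpham mu_tail Gg.
have g'B := coneG_ball pX Lam1 alpha0 alpham mu_tail Gg'.
have tauE : tau = Q^-1 ^+ 14 / 2 ^+ 14 by [].
apply: (hilbert_metric_contraction s0 sS) => //.
- exact: (coneF_cst1 pX Lam1 alpha0 alpham mu_tail).
- exact: (sinkhorn_map_L2 mK K0 K1 Kq (mB m) Q1 qB qQ mq tauE muq nuq nutau Ig g0 gI gB).
- exact: (sinkhorn_map_L2 mK K0 K1 Kq (mB m) Q1 qB qQ mq tauE muq nuq nutau Ig' g'0 g'I g'B).
- have pos x := sinkhorn_map_gt0 mK K0 K1 Kq (mB m) Q1 qB qQ mq tauE nuq nutau
    Ig' g'0 g'I g'B x.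
  (* The image is positive everywhere, so vanishing almost everywhere would make the whole space a
     null set. *)
  case=> A [mA A0 HA].
  suff AT : A = setT.
    have : 1%E = 0%E :> \bar R by rewrite -(probability_setT mu) -AT; exact: A0.
    by move=> /eqP; rewrite onee_eq0.
  apply/seteqP; split => // x _; apply: HA => /= E.
  by have := pos x; rewrite E ltxx.
- move=> k Fk; have [k2 kB _ _] := Fk.
  have lam0 := coneF_integral_ge0 pX alpha0 Fk.
  have kball := coneF_ball pX alpha0 alpham Fk.
  set lam := \int[mu]_x k x in lam0 kball.
  have Ik := L2_integrable k2.
  have [||||Ikq ktau] := @weight_tail _ _ _ _ pX x0 p _ m tau p0' m0 shell mu
      (Num.norm \o k) (2 * lam).
  - by move=> x /=.
  - exact: integrable_norm.
  - by rewrite mulr_ge0.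
  - move=> r mr; apply: le_trans (coneF_abs_tail pX Fk mr) _.
    by rewrite mulrAC.
  rewrite mulrAC in ktau.
  have hadj := sinkhorn_op_adjoint mK K0 K1 Kq (mB m) Q1 qB qQ mq tauE muq nuq
    nutau Ig g0 gI gB Ig' g'0 g'I g'B k2 kB kball Ikq ktau.
  have hge := sinkhorn_op_ge mK K0 K1 Kq (mB m) Q1 qB qQ mq tauE muq nuq
    nutau Ig g0 gI gB Ig' g'0 g'I g'B k2 kB kball Ikq ktau.
  have hle := sinkhorn_op_le mK K0 K1 Kq (mB m) Q1 qB qQ mq tauE muq nuq
    nutau Ig g0 gI gB Ig' g'0 g'I g'B k2 kB kball Ikq ktau.
  have mT := measurable_sinkhorn_op mK K0 K1 Kq (mB m) Q1 qB qQ mq tauE muq nuq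
    nutau Ig g0 gI gB Ig' g'0 g'I g'B k2 kB kball Ikq ktau.
  case: hadj => hadj hadj'.
  set T := sinkhorn_op K mu nu g g' k in hadj hadj' hge hle mT.
  exists T, lam; split => //.
  + by apply: (L2_le_norm (g := cst (128 * Q ^+ 8 * lam))) => //; exact: L2_cst.
  + have [h1 h2 -> h3 h4] := contraction_constants Q1 lam0.
    apply: (coneF_sandwich pX Lam1 alpha0 alpham mu_tail) => //.
    by move=> x; rewrite h3; exact: hge.
Qed.
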